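(* Let $\{X_n\}$ be a (stationary) binary renewal process with run-length distribution $\{p_k\}_{k\ge 0}$. Assume $\sum_{k=0}^{\infty} k^{\alpha+1}p_k<\infty$ for some $\alpha>2$. Let $0<\gamma<\min(1-2/\alpha,\,1/3)$. Let $\lambda_n$ be the stopping times and $h_n(X_0,\ldots,X_{\lambda_n})$, $\hat p_l(X_0,\ldots,X_{\lambda_n})$ ($l\ge 0$) the estimators defined (with this $\gamma$) in the context. Then, almost surely, $$\lim_{n\to\infty}\frac{\lambda_n}{n}=1,$$ $$\lim_{n\to\infty}\bigl|h_n(X_0,\ldots,X_{\lambda_n})-\theta_{\lambda_n}\bigr|=0,$$ and $$\lim_{n\to\infty}\sum_{l=0}^{\infty}\left|\hat p_l(X_0,\ldots,X_{\lambda_n})-\frac{p_{l+\tau(X_0^{\lambda_n})}}{\sum_{i=\tau(X_0^{\lambda_n})}^{\infty}p_i}\right|=0.$$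
   Context: **Binary renewal process.** Let $\{p_k\}_{k=0}^\infty$ be a probability distribution on $\{0,1,2,\ldots\}$ with $\mu=\sum_{k}kp_k<\infty$. Consider the Markov chain $\{M_n\}$ on $\{0,1,2,\ldots\}$ with transition probabilities $p_{i,i-1}=1$ for $i\ge1$ and $p_{0,i}=p_i$ for $i\ge 0$, started from its unique stationary distribution (which gives mass $1/(1+\mu)$ to state $0$). The binary renewal process is $X_n=0$ if $M_n=0$ and $X_n=1$ otherwise. It is stationary, and may be regarded as a two-sided process $\{X_n\}_{n\in\mathbb Z}$; $p_k$ is the conditional probability that a run of exactly $k$ ones follows a given zero. **Notation.** $X_i^j=(X_i,\ldots,X_j)$. - $\psi=\min\{t\ge0: X_t=0\}$ is the position of the first zero. - For $n\ge\psi$, $\tau(X_0^n)$ is the $t\ge0$ such that $X_{n-t}=0$ and $X_i=1$ for all $n-t<i\le n$ (time since the last zero). - $\sigma_i=\max\{l\ge0: X_j=1\text{ for all } i<j\le i+l\}$. - $\theta_n=E(\sigma_n\mid X_0^n)$. On $\{n\ge\psi\}$ one has $\theta_n=\dfrac{\sum_{k=0}^\infty k\,p_{k+\tau(X_0^n)}}{\sum_{k=\tau(X_0^n)}^\infty p_k}$. $\theta_{\lambda_n}$ denotes $\theta_m$ evaluated at the random index $m=\lambda_n$. **Stopping times and estimators** (depending on $\gamma\in(0,1)$). $\lambda_0=\psi$ and for $n\ge1$ $$\lambda_n=\min\{k>\lambda_{n-1}: |\{\psi\le i<k:\tau(X_0^i)=\tau(X_0^k)\}|\ge k^{1-\gamma}\}.$$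 For $n\ge1$, $$\kappa_n=\max\{K: |\{K\le k<\lambda_n:\tau(X_0^k)=\tau(X_0^{\lambda_n})\}|=\lceil\lambda_n^{1-\gamma}\rceil\},$$ (where only $k\ge\psi$ are counted), and $$h_n(X_0,\ldots,X_{\lambda_n})=\frac1{\lceil\lambda_n^{1-\gamma}\rceil}\sum_{i=\kappa_n}^{\lambda_n-1}I_{\{\tau(X_0^i)=\tau(X_0^{\lambda_n})\}}\,\sigma_i,$$ $$\hat p_l(X_0,\ldots,X_{\lambda_n})=\frac1{\lceil\lambda_n^{1-\gamma}\rceil}\sum_{i=\kappa_n}^{\lambda_n-1}I_{\{\tau(X_0^i)=\tau(X_0^{\lambda_n}),\ \sigma_i=l\}},\qquad l\ge0.$$ Here $I$ denotes the indicator function. *)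

(* Defs.v *)
(* MathComp-Analysis *)
From HB Require Import structures.
From mathcomp Require Import all_boot all_order all_algebra.
From mathcomp Require Import all_classical all_reals all_analysis.
Set Implicit Arguments.
Unset Strict Implicit.
Unset Printing Implicit Defensive.
Import Order.TTheory GRing.Theory Num.Theory.
Import numFieldNormedType.Exports.
Local Open Scope classical_set_scope.
Local Open Scope ring_scope.

(* The value is 0 when the set has no minimum (maximum); in what follows this
   happens only on a null event. *)
Definition natmin (A : set nat) : nat :=
  xget 0%N [set m | A m /\ forall k, A k -> (m <= k)%N].

Definition natmax (A : set nat) : nat :=
  xget 0%N [set m | A m /\ forall k, A k -> (k <= m)%N].

Section law.
Context {R : realType}.
Implicit Type p : nat -> R.

Definition run_length_distribution p : Prop :=
  [/\ forall k, 0 <= p k,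
      (\sum_(0 <= k <oo) (p k)%:E = 1)%E &
      (\sum_(0 <= k <oo) (k%:R * p k)%:E < +oo)%E].

Definition transition p (i j : nat) : R :=
  if i is i'.+1 then (j == i')%:R else p j.

Context d (T : measurableType d) (P : probability T R).

(* A Markov chain with the above transition probabilities whose initial law is
   invariant.  The Markov property is written without conditioning, so that
   histories of probability zero need no special treatment. *)
Definition stationary_renewal_chain p (M : nat -> T -> nat) : Prop :=
  [/\ forall n, measurable_fun setT (M n),
      forall j, (P [set w | M 0%N w = j] =
        \sum_(0 <= i <oo) P [set w | M 0%N w = i] * (transition p i j)%:E)%E &
      forall n (m : nat -> nat),
        (P [set w | forall i, (i <= n.+1)%N -> M i w = m i] =
         P [set w | forall i, (i <= n)%N -> M i w = m i] *
           (transition p (m n) (m n.+1))%:E)%E].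

Definition binary_renewal_process p (X : nat -> T -> nat) : Prop :=
  exists2 M : nat -> T -> nat, stationary_renewal_chain p M &
    forall n w, X n w = if M n w == 0%N then 0%N else 1%N.

(* The sigma-algebra generated by X_0, ..., X_n. *)
Definition history (X : nat -> T -> nat) (n : nat) : set (set T) :=
  <<s [set A | exists i v, (i <= n)%N /\ A = [set w | X i w = v]] >>.

(* Z is a version of the conditional expectation of Y given the
   sub-sigma-algebra G. *)
Definition is_cond_expectation (G : set (set T)) (Y Z : T -> R) : Prop :=
  [/\ forall B : set R, measurable B -> G (Z @^-1` B),
      P.-integrable setT (EFin \o Z) &
      forall A, G A ->
        (\int[P]_(w in A) (Z w)%:E = \int[P]_(w in A) (Y w)%:E)%E].

End law.

Section path_functionals.
Implicit Type x : nat -> nat.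

Definition psi x : nat := natmin [set t | x t = 0%N].

(* Depends on x_0, ..., x_n only; meaningful for n >= psi x, in which case such
   a t exists and is unique. *)
Definition tau x (n : nat) : nat :=
  xget 0%N [set t | [/\ (t <= n)%N, x (n - t)%N = 0%N &
                        forall i, (n - t < i <= n)%N -> x i = 1%N]].

Definition sigma x (i : nat) : nat :=
  natmax [set l | forall j, (i < j <= i + l)%N -> x j = 1%N].

(* The number of indices K <= i < k, i >= psi, with tau_i = tau_k. *)
Definition tau_matches x (K k : nat) : nat :=
  (\sum_(K <= i < k | (psi x <= i) && (tau x i == tau x k)) 1)%N.

Context {R : realType}.
Implicit Type gamma : R.

Fixpoint lambda gamma x (n : nat) : nat :=
  if n is n'.+1 then
    natmin [set k | (lambda gamma x n' < k)%N /\
                    k%:R `^ (1 - gamma) <= (tau_matches x (psi x) k)%:R]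
  else psi x.

Definition window gamma x (n : nat) : int :=
  Num.ceil ((lambda gamma x n)%:R `^ (1 - gamma)).

Definition kappa gamma x (n : nat) : nat :=
  natmax [set K | (tau_matches x K (lambda gamma x n))%:Z = window gamma x n].

Definition h_est gamma x (n : nat) : R :=
  let L := lambda gamma x n in
  ((window gamma x n)%:~R)^-1 *
  \sum_(kappa gamma x n <= i < L) (tau x i == tau x L)%:R * (sigma x i)%:R.

Definition p_est gamma x (n l : nat) : R :=
  let L := lambda gamma x n in
  ((window gamma x n)%:~R)^-1 *
  \sum_(kappa gamma x n <= i < L)
    ((tau x i == tau x L) && (sigma x i == l))%:R.

End path_functionals.

(* Main.v *)
Require Import Defs.
From HB Require Import structures.
From mathcomp Require Import all_boot all_order all_algebra.
From mathcomp Require Import all_classical all_reals all_analysis.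
From mathcomp Require Import measurable_realfun.
From mathcomp Require Import zify ring lra.
Set Implicit Arguments.
Unset Strict Implicit.
Unset Printing Implicit Defensive.
Import Order.TTheory GRing.Theory Num.Theory.
Import numFieldNormedType.Exports.
Local Open Scope classical_set_scope.
Local Open Scope ring_scope.

(** Let [M] be the underlying chain: almost surely [M n = i + 1] forces
    [M (n + 1) = i], so that [X n = 0] iff [M n = 0], [psi = M 0],
    [sigma n = M (n + 1)], and, for [n >= psi], [tau n = t] iff [t <= n],
    [M (n - t) = 0] and [t <= M (n - t + 1)].

    If [f] has mean 0 under [p], the terms [1(M s = 0) f(M (s + 1))] are
    martingale differences in the time [s], hence orthogonal, and dyadic chaining
    bounds the square of all increments of their partial sums over [0, 2^m] at
    the cost of a factor [(m + 1)^2].  With [f y = 1(t <= y) (u (y - t) - c)], where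
    [c = E(u(Y - t) | Y >= t)] for [Y] of law [p], such an increment is [W] times
    the error of the estimator of [E(u(sigma))] on a window of [W] times with
    [tau = t].  Since [W >= lambda^(1 - gamma)] and [gamma < 1/2], the resulting
    second moments are summable along dyadic scales even after summation over all
    [t] (and over [l], with weights [(l + t + 1)^2], for the total variation
    statement); only [E((Y + 1)^3) < oo] is needed for this.

    For [lambda n / n], the times [k < N] with [tau k = t] that are not selected
    number at most [N^(1 - gamma) + 1] for each [t], and the times with
    [tau >= log N] have density 0, so that the selected times have density 1. *)

(** * Paths *)

Lemma natmin_eq (A : set nat) m :
  A m -> (forall k, A k -> (m <= k)%N) -> natmin A = m.
Proof.
move=> Am mA; apply: xget_unique => // k [Ak kA].
by apply/eqP; rewrite eqn_leq kA //= mA.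
Qed.

Lemma natmax_eq (A : set nat) m :
  A m -> (forall k, A k -> (k <= m)%N) -> natmax A = m.
Proof.
move=> Am mA; apply: xget_unique => // k [Ak kA].
by apply/eqP; rewrite eqn_leq kA //= mA.
Qed.

Lemma natminP (A : set nat) : A !=set0 ->
  A (natmin A) /\ forall k, A k -> (natmin A <= k)%N.
Proof.
move=> [a Aa].
have exA : exists k, `[< A k >] by exists a; apply/asboolP.
case: (ex_minnP exA) => m /asboolP Am mA.
have mA' k : A k -> (m <= k)%N by move=> Ak; apply: mA; apply/asboolP.
by rewrite (@natmin_eq A m Am mA').
Qed.

Section renewal_path.
Variables M x : nat -> nat.
Hypothesis xE : forall n, x n = if M n == 0%N then 0%N else 1%N.
Hypothesis Mdecr : forall n i, M n = i.+1 -> M n.+1 = i.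

Lemma path_decr n i : (i <= M n)%N -> M (n + i)%N = (M n - i)%N.
Proof.
elim: i => [|i IH] lein; first by rewrite addn0 subn0.
rewrite addnS; apply: Mdecr; rewrite IH; lia.
Qed.

Lemma x_eq0 n : x n = 0%N <-> M n = 0%N.
Proof. by rewrite xE; case: eqP. Qed.

Lemma x_eq1 n : x n = 1%N <-> M n <> 0%N.
Proof. by rewrite xE; case: eqP. Qed.

Lemma psiE : psi x = M 0%N.
Proof.
apply: natmin_eq => [|k /= /x_eq0 Mk].
  by apply/x_eq0; rewrite -(add0n (M 0%N)) path_decr // subnn.
rewrite leqNgt; apply/negP => kM.
have := @path_decr 0 k; rewrite add0n Mk => /(_ (ltnW kM)); lia.
Qed.

Lemma sigmaE i : sigma x i = M i.+1.
Proof.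
apply: natmax_eq => [j /andP[ij ji]|k /= Hk].
  apply/x_eq1; have -> : j = (i.+1 + (j - i.+1))%N by lia.
  rewrite path_decr; lia.
rewrite leqNgt; apply/negP => Mk.
have /x_eq1 : x (i.+1 + M i.+1)%N = 1%N by apply: Hk; lia.
by rewrite path_decr // subnn.
Qed.

Lemma run_after_zero s t :
  (forall i, (s < i <= s + t)%N -> x i = 1%N) <-> (t <= M s.+1)%N.
Proof.
split=> [Hi|tM i /andP[si ist]].
  rewrite leqNgt; apply/negP => Mt.
  have /x_eq1 : x (s.+1 + M s.+1)%N = 1%N by apply: Hi; lia.
  by rewrite path_decr // subnn.
apply/x_eq1; have -> : i = (s.+1 + (i - s.+1))%N by lia.
rewrite path_decr; lia.
Qed.

(** The age is read off the chain at the two times [n - t] and [n - t + 1] only, so that its law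
    follows from a single transition. *)
Definition tau_spec n t :=
  [&& (t <= n)%N, M (n - t)%N == 0%N & (t <= M (n - t).+1)%N].

Lemma tau_specP n t : tau_spec n t <->
  [/\ (t <= n)%N, x (n - t)%N = 0%N &
      forall i, (n - t < i <= n)%N -> x i = 1%N].
Proof.
have E : (t <= n)%N -> (n - t + t)%N = n by lia.
split=> [/and3P[tn /eqP M0 /run_after_zero]|[tn /x_eq0 M0 H]].
  by rewrite E //; split=> //; apply/x_eq0.
by apply/and3P; split => //; [apply/eqP|apply/run_after_zero; rewrite E].
Qed.

Lemma tau_eq n t : tau_spec n t -> tau x n = t.
Proof.
move=> /tau_specP H; apply: xget_unique => // u [un xu Hu].
case: H => tn xt Ht.
have [ut|tu|//] := ltngtP u t.
  by have := Ht (n - u)%N; rewrite xu => H; suff: 0%N = 1%N by []; apply: H; lia.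
by have := Hu (n - t)%N; rewrite xt => H; suff: 0%N = 1%N by []; apply: H; lia.
Qed.

Lemma tauP n : (psi x <= n)%N -> tau_spec n (tau x n).
Proof.
rewrite psiE => Mn.
pose Z s := (s <= n)%N && (M s == 0%N).
have exZ : exists s, Z s.
  exists (M 0%N); rewrite /Z Mn /=.
  by rewrite -{1}(add0n (M 0%N)) path_decr // subnn.
have Zn s : Z s -> (s <= n)%N by case/andP.
case: (ex_maxnP exZ Zn) => s /andP[sn /eqP Ms] smax.
suff H : tau_spec n (n - s) by rewrite (tau_eq H).
have E : (n - (n - s))%N = s by lia.
rewrite /tau_spec leq_subr E Ms eqxx /= leqNgt; apply/negP => H.
(* A run too short to reach [n] would be closed by a zero after [s] and not after [n], against the
   maximality of [s]. *)
have : Z (s.+1 + M s.+1)%N.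
  apply/andP; split; first lia.
  by rewrite path_decr // subnn.
move=> /smax; lia.
Qed.

Lemma tauE n t : (psi x <= n)%N -> (tau x n == t) = tau_spec n t.
Proof.
move=> pn; apply/eqP/idP => [<-|]; [exact: tauP|exact: tau_eq].
Qed.

Lemma tau_matches_ge K L : (L <= K)%N -> tau_matches x K L = 0%N.
Proof. by move=> LK; rewrite /tau_matches big_geq. Qed.

Lemma tau_matchesS K L : (K < L)%N -> tau_matches x K L =
  (((psi x <= K) && (tau x K == tau x L)) + tau_matches x K.+1 L)%N.
Proof.
move=> KL; rewrite /tau_matches (big_cat_nat (n := K.+1)) //=.
congr addn; rewrite big_mkcond big_nat1; by case: ifP.
Qed.

(** As [K] grows, the number of matches in [[K, L)] drops by at most one per step and ends at 0. The
    largest [K] with at least [W] matches therefore has exactly [W], and the drop at [K + 1] shows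
    that [K] itself is a match. *)
Lemma kappa_spec L W : (0 < W)%N -> (W <= tau_matches x (psi x) L)%N ->
  exists K, [/\ natmax [set K | (tau_matches x K L)%:Z = W%:Z] = K,
   (psi x <= K)%N, (K < L)%N, tau x K = tau x L & tau_matches x K L = W].
Proof.
move=> W0 WL.
pose Z K := (W <= tau_matches x K L)%N.
have exZ : exists K, Z K by exists (psi x).
have ZL K : Z K -> (K <= L)%N.
  by move=> ZK; rewrite leqNgt; apply/negP => /ltnW/tau_matches_ge LK;
    move: ZK; rewrite /Z LK leqNgt W0.
case: (ex_maxnP exZ ZL) => K ZK Kmax.
have KL : (K < L)%N.
  rewrite ltn_neqAle ZL // andbT; apply/eqP => KL.
  by move: ZK; rewrite /Z tau_matches_ge ?KL // leqNgt W0.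
have SK : ~~ Z K.+1 by apply/negP => /Kmax; rewrite ltnn.
have := tau_matchesS KL; move: SK ZK; rewrite /Z -ltnNge.
case: andP => [[pK /eqP tK]|_] SK ZK E; last lia.
exists K; split => //; last lia.
apply: natmax_eq => /= [|k [Hk]]; first by congr Posz; lia.
by apply: Kmax; rewrite /Z Hk.
Qed.

(** Each match [i] is indexed by the zero [s = i - t] that precedes it; then
    [sigma x i = M i.+1 = M s.+1 - t]. Since [tau x K = t], one has [t <= K], so the natural
    subtractions are not truncated. *)
Lemma window_sum (R : realType) K L (u : nat -> R) (t := tau x L) :
  (psi x <= K)%N -> (K <= L)%N -> tau x K = t ->
  \sum_(K <= i < L) (tau x i == t)%:R * u (sigma x i) =
  \sum_(K - t <= s < L - t)
     (M s == 0%N)%:R * ((t <= M s.+1)%N%:R * u (M s.+1 - t)%N).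
Proof.
move=> pK KL tK.
have /and3P[tleK _ _] := tauP pK; rewrite tK in tleK.
rewrite -{1}(subnK tleK) -{1}(subnK (leq_trans tleK KL)).
rewrite (big_addn (K - t) _ t) addnK.
rewrite big_nat_cond [RHS]big_nat_cond; apply: eq_bigr => s /andP[/andP[Ks sL] _].
rewrite sigmaE tauE; last lia.
rewrite /tau_spec leq_addl addnK /=.
case: eqP => [Ms|_] /=; last by rewrite !mul0r.
rewrite mul1r; case: leqP => [tM|_]; last by rewrite !mul0r.
by rewrite -(@path_decr s.+1 t).
Qed.

End renewal_path.

(** * Dyadic chaining *)

Section dyadic_chaining.
Context {R : realType}.
Implicit Type S : nat -> R.

(** This is the sum of the squared increments of [S] over all dyadic subintervals of
    [[a, a + 2 ^ m]], of every level. *)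
Fixpoint chain_sq S (m a : nat) : R :=
  (S (a + 2 ^ m)%N - S a) ^+ 2 +
  if m is m'.+1 then chain_sq S m' a + chain_sq S m' (a + 2 ^ m')%N else 0.

Lemma chain_sq_ge0 S m a : 0 <= chain_sq S m a.
Proof.
elim: m a => [|m IH] a /=; first by rewrite addr0 sqr_ge0.
by rewrite !addr_ge0 ?sqr_ge0.
Qed.

Lemma chain_sq_top S m a : (S (a + 2 ^ m)%N - S a) ^+ 2 <= chain_sq S m a.
Proof. by case: m => [|m] /=; rewrite lerDl ?addr_ge0 ?chain_sq_ge0. Qed.

(** The interval [[a, a + n]] is a union of dyadic intervals, at most one of each level, so
    Cauchy-Schwarz costs the number [m + 1] of levels. In the induction, an [n] past the midpoint
    uses the whole left half and a remainder in the right half. *)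
Lemma le_chain_sq S m a n : (n <= 2 ^ m)%N ->
  (S (a + n)%N - S a) ^+ 2 <= m.+1%:R * chain_sq S m a.
Proof.
elim: m a n => [|m IH] a n.
  rewrite expn0 mul1r /= addr0 => n1.
  have [->|->] : n = 0%N \/ n = 1%N by lia.
    by rewrite addn0 subrr expr0n /= sqr_ge0.
  by rewrite expn0.
move=> nm /=; set Q1 := chain_sq S m a; set Q2 := chain_sq S m _.
have Q10 : 0 <= Q1 := chain_sq_ge0 _ _ _.
have Q20 : 0 <= Q2 := chain_sq_ge0 _ _ _.
apply: (@le_trans _ _ (m.+2%:R * (Q1 + Q2))); last first.
  by rewrite ler_wpM2l // lerDr sqr_ge0.
have m0 : (0 : R) < m.+1%:R by rewrite ltr0n.
have -> : (m.+2%:R : R) = m.+1%:R + 1 by rewrite -natr1.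
have [n2|n2] := leqP n (2 ^ m).
  apply: (le_trans (IH a n n2)); rewrite -/Q1.
  by apply: ler_pM; rewrite ?lerDl // ltW.
have /(IH (a + 2 ^ m)%N) : (n - 2 ^ m <= 2 ^ m)%N by move: nm; rewrite expnS; lia.
have -> : (a + 2 ^ m + (n - 2 ^ m))%N = (a + n)%N by lia.
have := chain_sq_top S m a; rewrite -/Q1 -/Q2.
set x := S (a + 2 ^ m)%N - S a; set y := S (a + n)%N - S (a + 2 ^ m)%N.
have -> : S (a + n)%N - S a = x + y by rewrite /x /y; ring.
move=> hx hy; set c : R := m.+1%:R in m0 hy *.
(* (x + y)^2 <= (c + 1) (x^2 + y^2 / c) *)
have H : c * (x + y) ^+ 2 <= (c + 1) * (c * x ^+ 2 + y ^+ 2).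
  by have := sqr_ge0 (c * x - y); nra.
rewrite -(ler_pM2l m0); apply: (le_trans H).
rewrite [leRHS]mulrCA; apply: ler_wpM2l; first by apply: addr_ge0 => //; exact: ltW.
by rewrite mulrDr lerD // ler_pM2l.
Qed.

(** Both values are compared with [S 0]; the factor 4 comes from [(x - y)^2 <= 2 x^2 + 2 y^2]. *)
Lemma sqr_incr_le_chain S m a b : (a <= 2 ^ m)%N -> (b <= 2 ^ m)%N ->
  (S b - S a) ^+ 2 <= 4 * m.+1%:R * chain_sq S m 0.
Proof.
move=> /(le_chain_sq S 0) + /(le_chain_sq S 0); rewrite !add0n.
set u := S b; set v := S a; set s := S 0%N; set q := _ * chain_sq _ _ _ => hv hu.
rewrite -mulrA -/q; have := sqr_ge0 ((u - s) + (v - s)); nra.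
Qed.

End dyadic_chaining.

(** * Conditioning on the past of the chain *)

Section chain_history.
Context {R : realType} {d} {T : measurableType d} (P : probability T R).
Variables (p : nat -> R) (M : nat -> T -> nat).
Hypothesis hp : run_length_distribution p.
Hypothesis hM : stationary_renewal_chain P p M.

Definition same_past n (w w' : T) := forall i, (i <= n)%N -> M i w = M i w'.

(** Measurability with respect to the past is expressed pointwise. The state space being countable,
    this implies measurability, whatever the target space. *)
Definition adapted {U : Type} n (G : T -> U) :=
  forall w w', same_past n w w' -> G w = G w'.

(** Coding the past by one natural number enumerates its atoms, so that integrals split into series
    over [nat]. *)
Definition history_code n w : nat := pickle [seq M i w | i <- iota 0 n.+1].

Lemma history_codeP n w w' :
  history_code n w = history_code n w' <-> same_past n w w'.
Proof.
rewrite /history_code; split=> [/(pcan_inj pickleK)/eq_in_map H i ni|H].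
  by apply: H; rewrite mem_iota; lia.
by congr pickle; apply/eq_in_map => i; rewrite mem_iota => ?; apply: H; lia.
Qed.

Lemma measurable_past n (m : nat -> nat) :
  measurable [set w | forall i, (i <= n)%N -> M i w = m i].
Proof.
rewrite (_ : mkset _ = \bigcap_(i in `I_n.+1) (M i @^-1` [set m i])); last first.
  by apply/seteqP; split=> w /= H i /= ni; apply: H.
apply: bigcap_measurableType => k _; rewrite -[X in measurable X]setTI.
by case: hM => mM _ _; exact: mM.
Qed.

Lemma measurable_history_code n k : measurable [set w | history_code n w = k].
Proof.
have [[w0 <-]|H] := pselect (exists w, history_code n w = k); last first.
  rewrite (_ : mkset _ = set0) //; apply/seteqP; split=> // w /= wk.
  by apply: H; exists w.
have := measurable_past n (M ^~ w0); congr (measurable _).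
by apply/seteqP; split=> w /history_codeP.
Qed.

Lemma adapted_measurable n (A : set T) : adapted n A -> measurable A.
Proof.
move=> aA.
rewrite (_ : A = \bigcup_(k in [set k | exists2 w, A w & history_code n w = k])
   [set w | history_code n w = k]).
  by apply: bigcup_measurable => k _; exact: measurable_history_code.
apply/seteqP; split=> [w Aw|w [k [w0 Aw0 <-]] /= /history_codeP ww0].
  by exists (history_code n w) => //; exists w.
by rewrite (aA _ _ ww0).
Qed.

Lemma adapted_measurable_fun {d'} {U : sigmaRingType d'} n (G : T -> U) :
  adapted n G -> measurable_fun setT G.
Proof.
move=> aG _ Y mY; rewrite setTI; apply: (@adapted_measurable n).
by move=> w w' H; rewrite /preimage /= (aG _ _ H).
Qed.

Lemma integral_history (A : set T) (G : T -> \bar R) n :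
  measurable A -> measurable_fun setT G -> (forall w, 0 <= G w)%E ->
  (\int[P]_(w in A) G w =
   \sum_(0 <= k <oo) \int[P]_(w in A `&` [set w | history_code n w = k]) G w)%E.
Proof.
move=> mA mG G0.
rewrite -ge0_integral_bigcup //.
- by rewrite -setI_bigcupr (_ : \bigcup_k _ = setT) ?setIT //;
    apply/seteqP; split=> // w _; exists (history_code n w).
- by move=> k; apply: measurableI => //; exact: measurable_history_code.
- exact: measurable_funTS.
- by move=> i j _ _ [w [[_ /= <-] [_ /= <-]]].
Qed.

Lemma adapted_zero n : adapted n [set w | M n w = 0%N].
Proof. by move=> w w' H /=; rewrite H. Qed.

(** On each atom of the past [G] is constant, and the chain hypothesis applied to that atom gives
    the factor [p y]; the atoms are then summed. *)
Lemma integral_next_run n y (G : T -> \bar R) : adapted n G ->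
  (forall w, 0 <= G w)%E ->
  (\int[P]_(w in [set w | M n w = 0%N] `&` [set w | M n.+1 w = y]) G w =
   (p y)%:E * \int[P]_(w in [set w | M n w = 0%N]) G w)%E.
Proof.
move=> aG G0.
have mG := adapted_measurable_fun aG.
have mZ := adapted_measurable (@adapted_zero n).
have mY : measurable [set w | M n.+1 w = y].
  by apply: (@adapted_measurable n.+1) => w w' H /=; rewrite H.
have p0 : 0 <= p y by case: hp.
rewrite (integral_history n (measurableI _ _ mZ mY)) // (integral_history n mZ) //.
rewrite -nneseriesZl; last by move=> i _; exact: integral_ge0.
apply: eq_eseriesr => k _.
have [[w0 [w0k /= Mw0]]|H] := pselect (exists w,
    history_code n w = k /\ M n w = 0%N); last first.
  rewrite (_ : _ `&` _ `&` _ = set0) ?integral_set0; last first.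
    by apply/seteqP; split=> // w [[Z _] /= wk]; apply: H; exists w.
  rewrite (_ : _ `&` _ = set0) ?integral_set0 ?mule0 //.
  by apply/seteqP; split=> // w [Z /= wk]; apply: H; exists w.
have E : (forall A : set T, measurable A -> A `<=` [set w | history_code n w = k] ->
   \int[P]_(w in A) G w = G w0 * P A)%E.
  move=> A mA Ak; rewrite -integral_cst //; apply: eq_integral => w /set_mem /Ak /=.
  by rewrite -w0k => /history_codeP ww0; exact: aG.
have mk := measurable_history_code n k.
rewrite E; [|by apply: measurableI => //; exact: measurableI|by move=> w []].
rewrite E; [|by apply: measurableI|by move=> w []].
rewrite muleCA; congr (_ * _)%E; rewrite muleC.
(* This is the path of the atom, prolonged by the value [y] at time [n + 1]. *)
pose m i := if (i <= n)%N then M i w0 else y.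
have [_ _ /(_ n m)] := hM.
rewrite {3 4}/m leqnn ltnn Mw0 /= => HM.
transitivity (P [set w | forall i, (i <= n.+1)%N -> M i w = m i]).
  congr (P _); apply/seteqP; split=> [w [[Zw /= Mw]] /=|w Hw].
    rewrite -w0k => /history_codeP ww0 i; rewrite /m leq_eqVlt ltnS.
    case: leqP => [ni _|ni]; first exact: ww0.
    by rewrite orbF => /eqP ->.
  have ww0 : same_past n w w0.
    by move=> i ni; rewrite Hw ?/m ?ni //; lia.
  split; last by rewrite /= -w0k; apply/history_codeP.
  by split=> /=; [rewrite ww0|rewrite Hw // /m ltnn].
rewrite HM; congr (P _ * _)%E; apply/seteqP; split=> w.
  move=> Hw.
  have ww0 : same_past n w w0 by move=> i ni; rewrite Hw // /m ni.
  by split; [rewrite /= ww0|rewrite /= -w0k; apply/history_codeP].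
move=> [Zw /=]; rewrite -w0k => /history_codeP ww0 i ni.
by rewrite /m ni; exact: ww0.
Qed.

(** This is the Markov property at a zero: given the past and [M n = 0], the next value has law [p].
    The integral is split according to that value. *)
Lemma integral_next (n : nat) (Phi : T -> nat -> \bar R) :
  (forall y, adapted n (Phi ^~ y)) -> (forall w y, 0 <= Phi w y)%E ->
  (\int[P]_(w in [set w | M n w = 0%N]) Phi w (M n.+1 w) =
   \int[P]_(w in [set w | M n w = 0%N]) \sum_(0 <= y <oo) (p y)%:E * Phi w y)%E.
Proof.
move=> aPhi Phi0.
have p0 y : 0 <= p y by case: hp.
have mZ := adapted_measurable (@adapted_zero n).
have mPhi : measurable_fun setT (fun w => Phi w (M n.+1 w)).
  apply: (@adapted_measurable_fun _ _ n.+1) => w w' H.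
  by rewrite H //; apply: aPhi => i ni; apply: H; lia.
have mphi y : measurable_fun setT (Phi ^~ y).
  exact: (@adapted_measurable_fun _ _ n).
rewrite integral_nneseries //; last first.
- by move=> y w _; rewrite mule_ge0 // lee_fin.
- by move=> y; apply: measurable_funTS; apply: measurable_funeM.
rewrite (_ : [set w | _] = \bigcup_y ([set w | M n w = 0%N] `&`
    [set w | M n.+1 w = y])); last first.
  by rewrite -setI_bigcupr (_ : \bigcup_k _ = setT) ?setIT //;
    apply/seteqP; split=> // w _; exists (M n.+1 w).
have mY y : measurable [set w | M n.+1 w = y].
  by apply: (@adapted_measurable n.+1) => w w' H /=; rewrite H.
rewrite ge0_integral_bigcup //; last 3 first.
- by move=> y; apply: measurableI.
- exact: measurable_funTS.
- by move=> i j _ _ [w [[_ /= <-] [_ /= <-]]].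
apply: eq_eseriesr => y _.
rewrite -setI_bigcupr (_ : \bigcup_k _ = setT) ?setIT; last first.
  by apply/seteqP; split=> // w _; exists (M n.+1 w).
rewrite ge0_integralZl //; [|exact: measurable_funTS|by rewrite lee_fin].
rewrite -integral_next_run //.
by apply: eq_integral => w /set_mem [_ /= ->].
Qed.

(** A path with a forbidden transition has probability 0 by the chain hypothesis, and there are only
    countably many finite paths. *)
Lemma ae_decr : {ae P, forall w, forall n i, M n w = i.+1 -> M n.+1 w = i}.
Proof.
apply: ae_foralln => n; apply: ae_foralln => i.
pose A := ~` [set w | M n w = i.+1 -> M n.+1 w = i].
suff : P.-negligible A by [].
have aA : adapted n.+1 A.
  by move=> w w' H; rewrite /A /setC /mkset !H.
apply: (@negligibleS _ _ _ _ (\bigcup_k (A `&` [set w | history_code n.+1 w = k]))).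
  by move=> w Aw; exists (history_code n.+1 w).
apply: negligible_bigcup => k.
have mA := adapted_measurable aA.
have mk := measurable_history_code n.+1 k.
apply/negligibleP; first exact: measurableI.
have [[w0 [w0k Aw0]]|H] :=
  pselect (exists w, history_code n.+1 w = k /\ A w); last first.
  rewrite (_ : _ `&` _ = set0) ?measure0 //; apply/seteqP; split=> // w [Aw /= wk].
  by apply: H; exists w.
have [_ _ /(_ n (M ^~ w0))] := hM.
have [Mi Mi1] : M n w0 = i.+1 /\ M n.+1 w0 <> i by apply/not_implyP.
rewrite Mi /= (_ : (M n.+1 w0 == i) = false) ?mule0; last by apply/eqP.
move=> H0; apply/eqP; rewrite -measure_le0 -{}H0; apply: le_measure.
- by rewrite inE; exact: measurableI.
- by rewrite inE; exact: measurable_past.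
- by move=> w [_ /=]; rewrite -w0k => /history_codeP.
Qed.

End chain_history.

(** * Centred sums *)

Section real_series.
Context {R : realType}.
Implicit Type u : nat -> R.

Lemma cvg_series_EFin u x : series u @ \oo --> x ->
  (\sum_(0 <= k <oo) (u k)%:E = x%:E)%E.
Proof.
move=> ux; apply/cvg_lim => //.
under eq_fun do rewrite sumEFin.
exact: (cvg_comp _ _ ux).
Qed.

Lemma nneseries_EFin_cvg u x : (forall k, 0 <= u k) ->
  (\sum_(0 <= k <oo) (u k)%:E = x%:E)%E -> series u @ \oo --> x.
Proof.
move=> u0 ux.
have : cvgn (fun n => \sum_(0 <= k < n) (u k)%:E)%E.
  by apply: is_cvg_nneseries => n _ _; rewrite lee_fin.
under eq_fun do rewrite sumEFin.
move=> /cvg_toP; move: ux; under eq_fun do rewrite sumEFin.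
move=> -> /(_ _ erefl)/fine_cvg; exact.
Qed.

Lemma nneseries_EFin_is_cvg u : (forall k, 0 <= u k) ->
  (\sum_(0 <= k <oo) (u k)%:E < +oo)%E -> cvgn (series u).
Proof.
move=> u0 uoo; have ge0 : (0 <= \sum_(0 <= k <oo) (u k)%:E)%E.
  by apply: nneseries_ge0 => n _ _; rewrite lee_fin.
have E : (\sum_(0 <= k <oo) (u k)%:E =
    (fine (\sum_(0 <= k <oo) (u k)%:E))%:E)%E by rewrite fineK // ge0_fin_numE.
exact: cvgP (nneseries_EFin_cvg u0 E).
Qed.

End real_series.

(** * Second moments of sums of centred terms over the zeros of the chain *)

Section centred_sums.
Context {R : realType} {d} {T : measurableType d} (P : probability T R).
Variables (p : nat -> R) (M : nat -> T -> nat).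
Hypothesis hp : run_length_distribution p.
Hypothesis hM : stationary_renewal_chain P p M.

(** The cross term vanishes because [g] depends on the past and [f] has mean 0 under [p]. The
    inequality comes from bounding [P(M n = 0)] by 1 in front of [v]. *)
Lemma integral_centred_step n (g : T -> R) (f : nat -> R) (v : R) :
  adapted M n g ->
  series (fun y => p y * f y) @ \oo --> (0 : R) ->
  series (fun y => p y * f y ^+ 2) @ \oo --> v ->
  (\int[P]_w ((g w + (M n w == 0%N)%:R * f (M n.+1 w)) ^+ 2)%:E <=
   \int[P]_w (g w ^+ 2)%:E + v%:E)%E.
Proof.
move=> ag pf pf2; have [p0 p1 _] := hp.
have cp1 := nneseries_EFin_cvg p0 p1.
have v0 : 0 <= v.
  have <- := cvg_lim (@Rhausdorff R) pf2.
  apply: limr_ge; first exact: cvgP pf2.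
  by near=> k; apply: sumr_ge0 => i _; rewrite mulr_ge0 // sqr_ge0.
pose Z := [set w | M n w = 0%N].
have mZ : measurable Z by apply: (adapted_measurable hM (@adapted_zero _ _ M n)).
pose F w := ((g w + (M n w == 0%N)%:R * f (M n.+1 w)) ^+ 2)%:E.
have mF : measurable_fun setT F.
  apply: (@adapted_measurable_fun _ _ _ _ _ _ hM _ _ n.+1) => w w' H.
  by rewrite /F !H // (ag _ w') // => i ni; apply: H; lia.
have mG : measurable_fun setT (fun w => (g w ^+ 2)%:E).
  by apply: (@adapted_measurable_fun _ _ _ _ _ _ hM _ _ n) => w w' /ag ->.
have F0 w : (0 <= F w)%E by rewrite lee_fin sqr_ge0.
have G0 w : (0 <= (g w ^+ 2)%:E)%E by rewrite lee_fin sqr_ge0.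
have split_Z (H : T -> \bar R) : measurable_fun setT H -> (forall w, 0 <= H w)%E ->
    (\int[P]_w H w = \int[P]_(w in Z) H w + \int[P]_(w in ~` Z) H w)%E.
  move=> mH H0; have mZc := measurableC mZ.
  rewrite -ge0_integral_setU ?setUv //.
  by apply/disj_setPS; rewrite setICr.
(* Off [Z] the added term is 0 and the two integrals agree; only the part on [Z] remains to be
   compared. *)
rewrite (split_Z F) // (split_Z (fun w => (g w ^+ 2)%:E)) //.
have -> : (\int[P]_(w in ~` Z) F w = \int[P]_(w in ~` Z) (g w ^+ 2)%:E)%E.
  apply: eq_integral => w /set_mem /eqP/negbTE H.
  by rewrite /F H mul0r addr0.
rewrite addeAC; apply: leeD => //.
have -> : (\int[P]_(w in Z) F w =
    \int[P]_(w in Z) ((g w + f (M n.+1 w)) ^+ 2)%:E)%E.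
  by apply: eq_integral => w /set_mem /eqP H; rewrite /F H mul1r.
rewrite (integral_next hp hM (Phi := fun w y => ((g w + f y) ^+ 2)%:E)); last 2 first.
- by move=> y w w' /ag ->.
- by move=> w y; rewrite lee_fin sqr_ge0.
rewrite (eq_integral (fun w => (g w ^+ 2)%:E + v%:E)%E); last first.
  move=> w _.
  under eq_eseriesr do rewrite -EFinM.
  rewrite -EFinD; apply: cvg_series_EFin.
  rewrite [X in X @ _ --> _](_ : _ = (fun k => g w ^+ 2 * series p k +
     (2 * g w * series (fun y => p y * f y) k +
      series (fun y => p y * f y ^+ 2) k))); last first.
    apply/funext => k; rewrite /series /= !mulr_sumr -!big_split /=.
    by apply: eq_bigr => y _; ring.
  rewrite -[X in _ --> X]addr0 -addrA -[X in _ --> X + _]mulr1 addrC.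
  rewrite [X in _ --> X](_ : _ = g w ^+ 2 * 1 + (2 * g w * 0 + v)); last by ring.
  apply: cvgD; first exact: cvgMl_tmp.
  by apply: cvgD => //; exact: cvgMl_tmp.
rewrite ge0_integralD //; last exact: measurable_funTS.
rewrite leeD2l // integral_cst // -[leRHS]mule1 lee_pmul //.
exact: probability_le1.
Unshelve. all: by end_near. Qed.

Variables (f : nat -> R) (v : R).
Hypothesis pf0 : series (fun y => p y * f y) @ \oo --> (0 : R).
Hypothesis pf2 : series (fun y => p y * f y ^+ 2) @ \oo --> v.

Definition walk w n := \sum_(0 <= s < n) (M s w == 0%N)%:R * f (M s.+1 w).

Lemma adapted_walk n : adapted M n (walk ^~ n).
Proof.
move=> w w' H; rewrite /walk; apply: eq_big_nat => s /andP[_ sn].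
by rewrite !H // ltnW.
Qed.

Lemma integral_walk_incr_le a k :
  (\int[P]_w ((walk w (a + k)%N - walk w a) ^+ 2)%:E <= (k%:R * v)%:E)%E.
Proof.
elim: k => [|k IH].
  under eq_integral do rewrite addn0 subrr expr0n /=.
  by rewrite integral0 mul0r.
pose g w := walk w (a + k)%N - walk w a.
have ag : adapted M (a + k) g.
  move=> w w' H; rewrite /g (adapted_walk H); congr (_ - _).
  by apply: adapted_walk => i ia; apply: H; lia.
have := integral_centred_step ag pf0 pf2.
under eq_integral do rewrite /g addrAC.
have E w : walk w (a + k.+1) = walk w (a + k) +
    (M (a + k) w == 0)%:R * f (M (a + k).+1 w).
  by rewrite addnS /walk big_nat_recr.
under [X in _ -> (X <= _)%E]eq_integral do rewrite E.
move=> /le_trans; apply.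
rewrite -natr1 mulrDl mul1r EFinD leeD2r //.
Qed.

Lemma measurable_walk_incr b c :
  measurable_fun setT (fun w => ((walk w b - walk w c) ^+ 2)%:E).
Proof.
apply: (@adapted_measurable_fun _ _ _ _ _ _ hM _ _ (maxn b c)) => w w' H.
by congr (((_ - _) ^+ 2)%:E); apply: adapted_walk => i ic; apply: H; lia.
Qed.

Lemma measurable_chain m a :
  measurable_fun setT (fun w => (chain_sq (walk w) m a)%:E).
Proof.
elim: m a => [|m IH] a /=.
  by under eq_fun do rewrite addr0; exact: measurable_walk_incr.
under eq_fun do rewrite !EFinD.
apply: emeasurable_funD; first exact: measurable_walk_incr.
by apply: emeasurable_funD; exact: IH.
Qed.

(** At each of the [m + 1] levels the dyadic intervals have total length [2 ^ m], hence contribute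
    at most [2 ^ m * v]. *)
Lemma integral_chain_le m a :
  (\int[P]_w (chain_sq (walk w) m a)%:E <= (m.+1%:R * (2 ^ m)%N%:R * v)%:E)%E.
Proof.
have mW := measurable_walk_incr; have mC := measurable_chain.
have W0 b c w : (0 <= ((walk w b - walk w c) ^+ 2)%:E)%E.
  by rewrite lee_fin sqr_ge0.
have C0 k b w : (0 <= (chain_sq (walk w) k b)%:E)%E.
  by rewrite lee_fin chain_sq_ge0.
elim: m a => [|m IH] a.
  under eq_integral do rewrite /= addr0.
  by rewrite mul1r; exact: integral_walk_incr_le.
under eq_integral do rewrite /= !EFinD.
rewrite ge0_integralD //; last 2 first.
- by move=> w _; rewrite adde_ge0.
- by apply: emeasurable_funD; exact: mC.
rewrite ge0_integralD //.
apply: (le_trans (leeD (integral_walk_incr_le _ _) (leeD (IH _) (IH _)))).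
rewrite -!EFinD lee_fin expnS natrM -[m.+2%:R]natr1.
by rewrite le_eqVlt; apply/orP; left; apply/eqP; ring.
Qed.

End centred_sums.

(** * Summation *)

Section summation.
Context {R : realType}.

Lemma nneseries_ge_term (f : nat -> \bar R) k :
  (forall i, 0 <= f i)%E -> (f k <= \sum_(0 <= i <oo) f i)%E.
Proof.
move=> f0; apply: le_trans (nneseries_lim_ge k.+1 (fun n _ _ => f0 n)).
by rewrite big_nat_recr //= leeDr // sume_ge0.
Qed.

(** After interchanging the sums, each [y] is met by the [y + 1] indices [t <= y]. This trades a sum
    over ages for one more power in the moment. *)
Lemma nneseries_triangle (g : nat -> nat -> R) (h : nat -> R) :
  (forall t y, 0 <= g t y) -> (forall t y, (t <= y)%N -> g t y <= h y) ->
  (forall t y, (y < t)%N -> g t y = 0) ->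
  (\sum_(0 <= t <oo) \sum_(0 <= y <oo) (g t y)%:E <=
   \sum_(0 <= y <oo) (y.+1%:R * h y)%:E)%E.
Proof.
move=> g0 gh gz.
rewrite nneseries_interchange; last by move=> i j; rewrite lee_fin.
apply: lee_nneseries => [y _ _|y _].
  by apply: nneseries_ge0 => t _ _; rewrite lee_fin.
rewrite (nneseries_split 0 y.+1); last by move=> t _; rewrite lee_fin.
rewrite add0n eseries0 ?adde0; last by move=> t yt _; rewrite gz.
rewrite sumEFin lee_fin.
apply: (@le_trans _ _ (\sum_(0 <= t < y.+1) h y)).
  rewrite big_nat [leRHS]big_nat; apply: ler_sum => t /andP[_ ty].
  by apply: gh; rewrite -ltnS.
by rewrite big_const_nat iter_addr_0 subn0 mulr_natl.
Qed.

(** Bernoulli's inequality, for the bound on [m.+1 * s ^+ m] below. *)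
Lemma one_plus_mul_le_exp (c : R) n : 0 <= c -> 1 + n%:R * c <= (1 + c) ^+ n.
Proof.
move=> c0; elim: n => [|n IH]; first by rewrite mul0r addr0 expr0.
rewrite exprS -natr1.
have n0 : (0 : R) <= n%:R by [].
apply: (@le_trans _ _ ((1 + c) * (1 + n%:R * c))); first by nra.
by rewrite ler_wpM2l // addr_ge0.
Qed.

Lemma mul_geometric_bounded (s : R) : 0 < s -> s < 1 ->
  exists2 L : R, 0 <= L & forall m, m.+1%:R * s ^+ m <= L.
Proof.
move=> s0 s1.
pose c := s^-1 - 1; have c0 : 0 < c by rewrite subr_gt0 invf_gt1.
pose L := 1 + c^-1.
have L0 : 0 <= L by rewrite addr_ge0 // invr_ge0 ltW.
exists L => // m.
have := one_plus_mul_le_exp m (ltW c0).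
have -> : 1 + c = s^-1 by rewrite /c; ring.
rewrite exprVn => H.
rewrite -ler_pdivlMr ?exprn_gt0 //; apply: le_trans (ler_wpM2l L0 H).
have -> : L * (1 + m%:R * c) = 1 + m%:R * c + c^-1 + m%:R * (c^-1 * c).
  by rewrite /L; ring.
rewrite mulVf ?gt_eqF // mulr1 -natr1.
have := mulr_ge0 (ler0n R m) (ltW c0); have : 0 <= c^-1 by rewrite invr_ge0 ltW.
lra.
Qed.

(** With [z = s ^+ 2], one factor [s ^+ m] keeps [m.+1] bounded and the other tends to 0. *)
Lemma mul_geometric_small (z e : R) : 0 < z -> z < 1 -> 0 < e ->
  exists m0, forall m, (m0 <= m)%N -> m.+1%:R * z ^+ m <= e.
Proof.
move=> z0 z1 e0; pose s := Num.sqrt z.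
have s0 : 0 < s by rewrite sqrtr_gt0.
have s1 : s < 1 by rewrite -sqrtr1 ltr_sqrt.
have [L L0 HL] := mul_geometric_bounded s0 s1.
have /cvg_expr : `|s| < 1 by rewrite gtr0_norm.
have e1 : 0 < e / (L + 1) by rewrite divr_gt0 // ltr_wpDl.
move=> /cvgrPdist_le/(_ _ e1)[m0 _ Hm0]; exists m0 => m /Hm0.
rewrite /= sub0r normrN gtr0_norm ?exprn_gt0 // => Hm.
have -> : z = s ^+ 2 by rewrite sqr_sqrtr // ltW.
rewrite -exprM mulnC exprM expr2 mulrA.
apply: (@le_trans _ _ ((L + 1) * (e / (L + 1)))).
  apply: ler_pM => //; rewrite ?mulr_ge0 ?exprn_ge0 ?(ltW s0) //.
  by apply: (le_trans (HL m)); rewrite lerDl.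
by rewrite mulrCA mulfV ?mulr1 // gt_eqF // ltr_wpDl.
Qed.

(** Two of the three factors [s ^+ m] absorb [m.+1 ^+ 2], and the third leaves a geometric
    series. *)
Lemma sqr_mul_geometric_summable (s K : R) : 0 < s -> s < 1 -> 0 <= K ->
  (\sum_(0 <= m <oo) (m.+1%:R ^+ 2 * (s ^+ 3) ^+ m * K)%:E < +oo)%E.
Proof.
move=> s0 s1 K0; have [L L0 HL] := mul_geometric_bounded s0 s1.
have Nz : `|s| < 1 by rewrite gtr0_norm.
have := cvg_series_EFin (@cvg_geometric_series R (L ^+ 2 * K) s Nz).
set x := _ / _ => E.
apply: (@le_lt_trans _ _ x%:E); last exact: ltry.
rewrite -E; apply: lee_nneseries => [m _ _|m _].
  by rewrite lee_fin !mulr_ge0 // !exprn_ge0 // ltW.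
rewrite lee_fin /geometric /=.
have -> : m.+1%:R ^+ 2 * (s ^+ 3) ^+ m * K = (m.+1%:R * s ^+ m) ^+ 2 * (K * s ^+ m).
  by rewrite -exprM mulnC exprM; ring.
rewrite -[leRHS]mulrA; apply: ler_wpM2r.
  by rewrite mulr_ge0 // exprn_ge0 // ltW.
by rewrite ler_pXn2r // nnegrE ?(le_trans _ (HL m)) // mulr_ge0 // exprn_ge0 // ltW.
Qed.

End summation.

(** * Almost sure smallness from summable expectations *)

Section almost_sure.
Context {R : realType} {d} {T : measurableType d} (P : probability T R).

(** The sum of the [F m] is integrable, hence almost surely finite, and a term of a convergent
    nonnegative series is at most the corresponding tail. *)
Lemma ae_summable_small (F : nat -> T -> \bar R) :
  (forall m, measurable_fun setT (F m)) -> (forall m w, 0 <= F m w)%E ->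
  (\sum_(0 <= m <oo) \int[P]_w F m w < +oo)%E ->
  {ae P, forall w, forall e : R, 0 < e ->
    exists m0, forall m, (m0 <= m)%N -> (F m w <= e%:E)%E}.
Proof.
move=> mF F0 Foo.
have S0 w : (0 <= \sum_(0 <= m <oo) F m w)%E by exact: nneseries_ge0.
have iF : P.-integrable setT (fun w => \sum_(0 <= m <oo) F m w)%E.
  apply/integrableP; split.
    exact: (ge0_emeasurable_sum (P := xpredT)).
  under eq_integral do rewrite gee0_abs //.
  by rewrite integral_nneseries.
apply: filterS (integrable_ae measurableT iF) => w /(_ I) Sfin e e0.
have Soo : (\sum_(0 <= m <oo) F m w < +oo)%E by rewrite ltey_eq Sfin.
have /fine_cvgP[[m1 _ H1] /cvgrPdist_le/(_ e e0)[m2 _ H2]] :=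
  nneseries_tail_cvg Soo (fun k _ => F0 k w).
exists (maxn m1 m2) => m; rewrite geq_max => /andP[m1m m2m].
have := H2 m m2m; rewrite /= sub0r normrN => H.
apply: (@le_trans _ _ (\sum_(m <= k <oo) F k w)%E).
  have := @nneseries_lim_ge R (F ^~ w) xpredT m m.+1 (fun n _ _ => F0 n w).
  by rewrite big_nat1.
rewrite -(fineK (H1 m m1m)) lee_fin; apply: le_trans H; exact: ler_norm.
Qed.

(** The weight cancels [2 ^ m] and leaves expectations at most [m.+1 ^+ 2 * (s ^+ 3) ^+ m * K]: one
    factor [m.+1] is the loss of chaining, the other comes from the number of levels. *)
Lemma ae_dyadic_small (G : nat -> T -> \bar R) (s K : R) :
  0 < s -> s < 1 -> 0 <= K ->
  (forall m, measurable_fun setT (G m)) -> (forall m w, 0 <= G m w)%E ->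
  (forall m, \int[P]_w G m w <= (m.+1%:R * (2 ^ m)%N%:R * K)%:E)%E ->
  {ae P, forall w, forall e : R, 0 < e -> exists m0, forall m, (m0 <= m)%N ->
    ((m.+1%:R * (s ^+ 3) ^+ m / (2 ^ m)%N%:R)%:E * G m w <= e%:E)%E}.
Proof.
move=> s0 s1 K0 mG G0 intG.
have c0 m : 0 <= m.+1%:R * (s ^+ 3) ^+ m / (2 ^ m)%N%:R.
  by rewrite !mulr_ge0 ?invr_ge0 // !exprn_ge0 // ltW.
apply: ae_summable_small.
- by move=> m; apply: measurable_funeM.
- by move=> m w; rewrite mule_ge0 // lee_fin.
apply: le_lt_trans (sqr_mul_geometric_summable s0 s1 K0).
apply: lee_nneseries => [m _ _|m _].
  by apply: integral_ge0 => w _; rewrite mule_ge0 // lee_fin.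
rewrite ge0_integralZl_EFin //.
apply: (le_trans (lee_wpmul2l _ (intG m))); first by rewrite lee_fin.
rewrite -EFinM lee_fin le_eqVlt; apply/orP; left; apply/eqP.
by field; rewrite pnatr_eq0 expn_eq0.
Qed.

End almost_sure.

(** * Law of the residual run length *)

Section residual_law.
Context {R : realType}.
Variable p : nat -> R.
Hypothesis hp : run_length_distribution p.
Hypothesis p3 : (\sum_(0 <= y <oo) (y.+1%:R ^+ 3 * p y)%:E < +oo)%E.

Definition tail t : R := (\big[+%R/0]_(t <= i <oo) p i)%R.

Definition over t (u : nat -> R) y : R := (t <= y)%N%:R * u (y - t)%N.

(* E[u(Y - t); Y >= t], Y of law p *)
Definition tail_sum t u : R := limn (series (fun y => p y * over t u y)).

(** The cubic growth allowed for [u] is what comparison with the third moment can afford. *)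
Lemma over_sum_cvg t u : (forall l, 0 <= u l <= l.+1%:R ^+ 3) ->
  series (fun y => p y * over t u y) @ \oo --> tail_sum t u.
Proof.
have [p0 _ _] := hp => hu.
have o0 y : 0 <= over t u y by rewrite mulr_ge0 //; case/andP: (hu (y - t)%N).
apply: (@series_le_cvg _ _ (fun y => y.+1%:R ^+ 3 * p y)).
- by move=> y; rewrite mulr_ge0.
- by move=> y; rewrite mulr_ge0 // exprn_ge0.
- move=> y; rewrite mulrC ler_wpM2r // /over.
  case: leqP => [ty|_]; last by rewrite mul0r exprn_ge0.
  rewrite mul1r; have /andP[_ /le_trans] := hu (y - t)%N; apply.
  by rewrite lerXn2r ?nnegrE // ler_nat ltnS leq_subr.
- by apply: nneseries_EFin_is_cvg => // y; rewrite mulr_ge0 // exprn_ge0.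
Qed.

Lemma over_sumE t u : (forall l, 0 <= u l <= l.+1%:R ^+ 3) ->
  (\sum_(0 <= y <oo) (p y * over t u y)%:E = (tail_sum t u)%:E)%E.
Proof. by move=> hu; apply: cvg_series_EFin; exact: over_sum_cvg. Qed.

Lemma tail_sum_ge0 t u : (forall l, 0 <= u l <= l.+1%:R ^+ 3) ->
  0 <= tail_sum t u.
Proof.
move=> hu; rewrite -lee_fin -over_sumE //; apply: nneseries_ge0 => y _ _.
have [p0 _ _] := hp.
by rewrite lee_fin !mulr_ge0 //; case/andP: (hu (y - t)%N).
Qed.

Lemma one_le_cube l : 0 <= (1 : R) <= l.+1%:R ^+ 3.
Proof. by rewrite ler01 exprn_ege1 // ler1n. Qed.

Lemma tailE t : tail t = tail_sum t (fun=> 1).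
Proof.
congr (limn _); apply/funext => n; rewrite /series /=.
rewrite (big_nat_widenl t 0) //= big_mkcond /=; apply: eq_bigr => y _.
by rewrite /over mulr1; case: (t <= y)%N; rewrite ?mulr1 ?mulr0.
Qed.

Lemma tail_cvg t : series (fun y => p y * over t (fun=> 1) y) @ \oo --> tail t.
Proof. by rewrite tailE; apply: over_sum_cvg => l; exact: one_le_cube. Qed.

Lemma tail0_mass t y : tail t = 0 -> (t <= y)%N -> p y = 0.
Proof.
have [p0 _ _] := hp => t0 ty; apply/le_anti; rewrite p0 andbT.
have H := over_sumE t one_le_cube.
rewrite -tailE t0 in H; rewrite -lee_fin -H.
have /(_ y) := @nneseries_ge_term _ (fun y => (p y * over t (fun=> 1) y)%:E).
rewrite /over ty !mulr1; apply => i.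
by rewrite lee_fin mulr_ge0 // mulr1.
Qed.

(** Where [tail t] vanishes, the quotient by it is 0 by convention; this lemma keeps the identity
    [tail_sum t u = c * tail t] true for that quotient [c]. *)
Lemma tail_sum_eq0 t u : (forall l, 0 <= u l <= l.+1%:R ^+ 3) ->
  tail t = 0 -> tail_sum t u = 0.
Proof.
move=> hu t0; apply: EFin_inj; rewrite -over_sumE // eseries0 // => y _ _.
rewrite /over; case: leqP => ty; last by rewrite mul0r mulr0.
by rewrite (tail0_mass t0 ty) mul0r.
Qed.

Definition resid t (u : nat -> R) y : R :=
  over t (fun l => u l - tail_sum t u / tail t) y.

(** The subtracted constant is the conditional mean of [u] given [Y >= t], and a variance is at most
    the second moment: the two terms in [c] add up to [- c * tail_sum t u <= 0]. Linear growth of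
    [u] makes [u ^+ 2] admissible in [over_sum_cvg]. *)
Lemma resid_centred t u : (forall l, 0 <= u l <= l.+1%:R) ->
  series (fun y => p y * resid t u y) @ \oo --> (0 : R) /\
  exists2 v, v <= tail_sum t (fun l => u l ^+ 2) &
    series (fun y => p y * resid t u y ^+ 2) @ \oo --> v.
Proof.
move=> hu1.
have hu l : 0 <= u l <= l.+1%:R ^+ 3.
  have /andP[-> /le_trans -> //] := hu1 l.
  by rewrite -[leLHS]expr1 ler_weXn2l // ler1n.
have hu2 l : 0 <= u l ^+ 2 <= l.+1%:R ^+ 3.
  have /andP[ul0 ul] := hu1 l; rewrite exprn_ge0 //=.
  apply: (@le_trans _ _ (l.+1%:R ^+ 2)); first by rewrite lerXn2r ?nnegrE.
  by rewrite ler_weXn2l // ler1n.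
have A := @tail_cvg t.
have B := @over_sum_cvg t _ hu.
have C := @over_sum_cvg t _ hu2.
set c := tail_sum t u / tail t.
have Bc : tail_sum t u = c * tail t.
  rewrite /c; have [t0|t0] := eqVneq (tail t) 0; last by rewrite divfK.
  by rewrite t0 mulr0 tail_sum_eq0.
have c0 : 0 <= c.
  rewrite divr_ge0 ?tail_sum_ge0 // tailE tail_sum_ge0 // => l.
  exact: one_le_cube.
split.
  rewrite [X in X @ _ --> _](_ : _ = (fun n => series (fun y => p y * over t u y) n
     - c * series (fun y => p y * over t (fun=> 1) y) n)); last first.
    apply/funext => n; rewrite /series /= mulr_sumr -sumrB.
    by apply: eq_bigr => y _; rewrite /resid /over -/c; ring.
  rewrite -[X in _ --> X](subrr (tail_sum t u)) {2}Bc.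
  by apply: cvgB => //; exact: cvgMl_tmp.
exists (tail_sum t (fun l => u l ^+ 2) - 2 * c * tail_sum t u + c ^+ 2 * tail t).
  have := mulr_ge0 c0 (tail_sum_ge0 t hu).
  rewrite expr2 -(mulrA c c) -Bc; lra.
rewrite [X in X @ _ --> _](_ : _ =
   (fun n => series (fun y => p y * over t (fun l => u l ^+ 2) y) n
     - 2 * c * series (fun y => p y * over t u y) n
     + c ^+ 2 * series (fun y => p y * over t (fun=> 1) y) n)); last first.
  apply/funext => n; rewrite /series /= !mulr_sumr -sumrB -big_split /=.
  apply: eq_bigr => y _; rewrite /resid /over -/c.
  by case: (t <= y)%N; rewrite /= ?mul0r ?mul1r; ring.
by apply: cvgD; [apply: cvgB => //; exact: cvgMl_tmp|exact: cvgMl_tmp].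
Qed.

Lemma tail_sum_point t l :
  tail_sum t (fun k => (k == l)%:R) = p (l + t)%N.
Proof.
apply/cvg_lim => //; apply: cvg_near_cst; exists (l + t).+1 => //= n /= ln.
rewrite /series /= big_mkord (bigD1 (Ordinal ln)) //= big1 => [|i /negPf il].
  by rewrite addr0 /over leq_addl addnK eqxx !mulr1.
rewrite /over; case: leqP => ti; last by rewrite mul0r mulr0.
suff -> : (i - t == l)%N = false by rewrite mulr0 mulr0.
apply/negP => /eqP E; move/negP: il; apply; apply/eqP/val_inj => /=.
by rewrite -E subnK.
Qed.

Lemma summable_tail_sum_sq :
  (\sum_(0 <= t <oo) (tail_sum t (fun l => (l%:R : R) ^+ 2))%:E < +oo)%E.
Proof.
have [p0 _ _] := hp; apply: le_lt_trans p3.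
have hu l : 0 <= (l%:R : R) ^+ 2 <= l.+1%:R ^+ 3.
  rewrite exprn_ge0 //=; apply: (@le_trans _ _ (l.+1%:R ^+ 2)).
    by rewrite lerXn2r ?nnegrE // ler_nat.
  by rewrite ler_weXn2l // ler1n.
under eq_eseriesr do rewrite -over_sumE //.
under [leRHS]eq_eseriesr do rewrite exprS -mulrA.
apply: nneseries_triangle => [t y|t y ty|t y yt].
- by rewrite !mulr_ge0 // exprn_ge0.
- rewrite mulrC ler_wpM2r // /over ty mul1r lerXn2r ?nnegrE // ler_nat; lia.
- by rewrite /over leqNgt yt /= mul0r mulr0.
Qed.

Lemma summable_point_weights :
  (\sum_(0 <= t <oo) \sum_(0 <= y <oo)
     ((t <= y)%N%:R * y.+1%:R ^+ 2 * p y)%:E < +oo)%E.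
Proof.
have [p0 _ _] := hp; apply: le_lt_trans p3.
under [leRHS]eq_eseriesr do rewrite exprS -mulrA.
apply: nneseries_triangle => [t y|t y ty|t y yt].
- by rewrite !mulr_ge0 // exprn_ge0.
- by rewrite ty mul1r.
- by rewrite leqNgt yt /= !mul0r.
Qed.

(** The triangle interchange is used twice, first for [m <= j] and then for [j <= y], which raises
    the mass [p y] to the second moment; this is below the third. *)
Lemma summable_tails :
  (\sum_(0 <= m <oo) \sum_(0 <= j <oo) ((m <= j)%N%:R * tail j)%:E < +oo)%E.
Proof.
have [p0 _ _] := hp; apply: le_lt_trans p3.
have t0 j : 0 <= tail j by rewrite tailE tail_sum_ge0 // => l; exact: one_le_cube.
apply: (@le_trans _ _ (\sum_(0 <= j <oo) (j.+1%:R * tail j)%:E)%E).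
  apply: nneseries_triangle => [m j|m j mj|m j jm].
  - by rewrite mulr_ge0.
  - by rewrite mj mul1r.
  - by rewrite leqNgt jm /= mul0r.
apply: (@le_trans _ _ (\sum_(0 <= j <oo) \sum_(0 <= y <oo)
    ((j <= y)%N%:R * (j.+1%:R * p y))%:E)%E).
  apply: lee_nneseries => [j _ _|j _]; first by rewrite lee_fin mulr_ge0.
  rewrite tailE EFinM -over_sumE; last exact: one_le_cube.
  rewrite -nneseriesZl; last first.
    by move=> y _; rewrite lee_fin !mulr_ge0.
  apply: lee_nneseries => [y _ _|y _].
    by rewrite -EFinM lee_fin !mulr_ge0.
  rewrite -EFinM lee_fin /over le_eqVlt; apply/orP; left; apply/eqP; ring.
apply: (@le_trans _ _ (\sum_(0 <= y <oo) (y.+1%:R * (y.+1%:R * p y))%:E)%E).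
  apply: nneseries_triangle => [j y|j y jy|j y yj].
  - by rewrite !mulr_ge0.
  - by rewrite jy mul1r ler_wpM2r // ler_nat.
  - by rewrite leqNgt yj /= mul0r.
apply: lee_nneseries => [y _ _|y _]; first by rewrite lee_fin !mulr_ge0.
by rewrite lee_fin mulrA -expr2 ler_wpM2r // ler_weXn2l // ler1n.
Qed.

End residual_law.

(** * Almost sure bounds *)

Section almost_sure_bounds.
Context {R : realType} {d} {T : measurableType d} (P : probability T R).
Variables (p : nat -> R) (M : nat -> T -> nat).
Hypothesis hp : run_length_distribution p.
Hypothesis hM : stationary_renewal_chain P p M.
Hypothesis p3 : (\sum_(0 <= y <oo) (y.+1%:R ^+ 3 * p y)%:E < +oo)%E.
Variable s : R.
Hypotheses (s0 : 0 < s) (s1 : s < 1).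

(** For [s ^+ 3 = 2 ^ (gamma - 1/2)], a further factor [(s ^+ 3) ^+ m] turns this into
    [m.+1 / pow_scale m ^+ 2], the scale of the squared estimation error. That factor is kept in
    reserve. *)
Definition rate m : R := m.+1%:R * (s ^+ 3) ^+ m / (2 ^ m)%N%:R.

Lemma rate_ge0 m : 0 <= rate m.
Proof. by rewrite !mulr_ge0 ?invr_ge0 // !exprn_ge0 // ltW. Qed.

Lemma integral_chain_resid_le t u m : (forall l, 0 <= u l <= l.+1%:R) ->
  (\int[P]_w (chain_sq (walk M (resid p t u) w) m 0)%:E <=
   (m.+1%:R * (2 ^ m)%N%:R * tail_sum p t (fun l => u l ^+ 2))%:E)%E.
Proof.
move=> hu; have [pf [v vC pf2]] := resid_centred hp p3 t hu.
apply: (le_trans (integral_chain_le hp hM pf pf2 m 0)).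
by rewrite lee_fin ler_wpM2l // mulr_ge0.
Qed.

(** The age at [lambda n] is random, so the bound must be uniform in [t]. It is obtained by summing
    over all [t], the variances being summable. *)
Lemma ae_mean_chain_small :
  {ae P, forall w, forall e : R, 0 < e -> exists m0, forall m, (m0 <= m)%N ->
    forall t, rate m * chain_sq (walk M (resid p t (fun l => l%:R)) w) m 0 <= e}.
Proof.
have [p0 _ _] := hp.
have hu l : 0 <= (l%:R : R) <= l.+1%:R by rewrite ler0n ler_nat leqnSn.
pose c t w m := (chain_sq (walk M (resid p t (fun l => l%:R)) w) m 0)%:E.
have c0 t w m : (0 <= c t w m)%E by rewrite lee_fin chain_sq_ge0.
have mc t m : measurable_fun setT (fun w => c t w m).
  exact: (measurable_chain hM (resid p t (fun l => l%:R)) m 0).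
pose v t : R := tail_sum p t (fun l => (l%:R : R) ^+ 2).
have voo := summable_tail_sum_sq hp p3.
have v0 t : 0 <= v t.
  apply: (tail_sum_ge0 hp p3) => l; rewrite exprn_ge0 //=.
  apply: (@le_trans _ _ (l.+1%:R ^+ 2)).
    by rewrite lerXn2r ?nnegrE // ler_nat.
  by rewrite ler_weXn2l // ler1n.
have K0 : (0 <= \sum_(0 <= t <oo) (v t)%:E)%E.
  by apply: nneseries_ge0 => t _ _; rewrite lee_fin.
have := @ae_dyadic_small _ _ _ P (fun m w => \sum_(0 <= t <oo) c t w m)%E
  s (fine (\sum_(0 <= t <oo) (v t)%:E)%E) s0 s1 (fine_ge0 K0).
move=> H; apply: filterS (H _ _ _).
- move=> w Hw e e0; have [m0 Hm] := Hw e e0; exists m0 => m m0m t.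
  rewrite -lee_fin EFinM; apply: le_trans (Hm m m0m).
  apply: lee_wpmul2l; first by rewrite lee_fin rate_ge0.
  by apply: (@nneseries_ge_term _ (fun t => c t w m)).
- move=> m; exact: (ge0_emeasurable_sum (P := xpredT)).
- by move=> m w; exact: nneseries_ge0.
move=> m; rewrite integral_nneseries //.
rewrite EFinM fineK ?ge0_fin_numE // -nneseriesZl; last first.
  by move=> t _; rewrite lee_fin.
apply: lee_nneseries => [t _ _|t _]; first exact: integral_ge0.
by rewrite -EFinM; exact: (integral_chain_resid_le t m hu).
Qed.

(** The weights [(l + t + 1)^2] will pay for the sum over [l] of absolute errors. They are
    affordable because the variance for the point [l] is at most [p (l + t)]. *)
Lemma ae_point_chain_small :
  {ae P, forall w, forall e : R, 0 < e -> exists m0, forall m, (m0 <= m)%N ->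
    forall t, ((rate m)%:E * \sum_(0 <= l <oo)
     ((l + t).+1%:R ^+ 2 *
       chain_sq (walk M (resid p t (fun k => (k == l)%:R)) w) m 0)%:E <= e%:E)%E}.
Proof.
have [p0 _ _] := hp.
have hu l k : 0 <= ((k == l)%:R : R) <= k.+1%:R.
  by rewrite ler0n ler_nat; case: (k == l).
pose c t l w m := (chain_sq (walk M (resid p t (fun k => (k == l)%:R)) w) m 0)%:E.
have c0 t l w m : (0 <= c t l w m)%E by rewrite lee_fin chain_sq_ge0.
have mc t l m : measurable_fun setT (fun w => c t l w m).
  exact: (measurable_chain hM (resid p t (fun k => (k == l)%:R)) m 0).
pose a t l : R := (l + t).+1%:R ^+ 2.
have a0 t l : 0 <= a t l by exact: exprn_ge0.
have ac0 t l w m : (0 <= (a t l)%:E * c t l w m)%E 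
  by apply: mule_ge0; [rewrite lee_fin|exact: c0].
have mac t l m : measurable_fun setT (fun w => (a t l)%:E * c t l w m)%E.
  exact: measurable_funeM.
have sq_point l : (fun k => ((k == l)%:R : R) ^+ 2) = (fun k => (k == l)%:R).
  by apply/funext => k; case: (k == l); rewrite ?expr1n ?expr0n.
pose v := (\sum_(0 <= t <oo) \sum_(0 <= l <oo) (a t l * p (l + t)%N)%:E)%E.
have v00 t l : 0 <= a t l * p (l + t)%N by rewrite mulr_ge0.
have v0 : (0 <= v)%E.
  by apply: nneseries_ge0 => t _ _; apply: nneseries_ge0 => l _ _; rewrite lee_fin.
have voo : (v < +oo)%E.
  apply: le_lt_trans (summable_point_weights hp p3).
  apply: lee_nneseries => [t _ _|t _].
    by apply: nneseries_ge0 => l _ _; rewrite lee_fin.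
  pose g y : \bar R := ((t <= y)%N%:R * y.+1%:R ^+ 2 * p y)%:E.
  have g0 y : (0 <= g y)%E by rewrite lee_fin !mulr_ge0 // exprn_ge0.
  (* The index is shifted by [y = l + t], and the nonnegative terms with [y < t] are dropped. *)
  rewrite [leRHS](_ : _ = \sum_(0 <= y <oo) g y)%E // (nneseries_split 0 t) //.
  rewrite add0n -nneseries_addn // -[leLHS]add0e; apply: leeD.
    by apply: sume_ge0.
  apply: lee_nneseries => [l _ _|l _]; first by rewrite lee_fin.
  by rewrite /g leq_addl mul1r.
have := @ae_dyadic_small _ _ _ P
  (fun m w => \sum_(0 <= t <oo) \sum_(0 <= l <oo) (a t l)%:E * c t l w m)%E
  s (fine v) s0 s1 (fine_ge0 v0).
move=> H; apply: filterS (H _ _ _).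
- move=> w Hw e e0; have [m0 Hm] := Hw e e0; exists m0 => m m0m t.
  apply: le_trans (Hm m m0m).
  apply: lee_wpmul2l; first by rewrite lee_fin rate_ge0.
  apply: (@nneseries_ge_term _
    (fun t => \sum_(0 <= l <oo) (a t l)%:E * c t l w m)%E) => i.
  exact: nneseries_ge0.
- move=> m; apply: (ge0_emeasurable_sum (P := xpredT)) => [t w _ _|t _].
    exact: nneseries_ge0.
  exact: (ge0_emeasurable_sum (P := xpredT)).
- by move=> m w; apply: nneseries_ge0 => t _ _; exact: nneseries_ge0.
move=> m; rewrite integral_nneseries //; last 2 first.
- by move=> t; exact: (ge0_emeasurable_sum (P := xpredT)).
- by move=> t w _; exact: nneseries_ge0.
rewrite EFinM fineK ?ge0_fin_numE // -nneseriesZl; last first.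
  by move=> t _; apply: nneseries_ge0 => l _ _; rewrite lee_fin.
apply: lee_nneseries => [t _ _|t _].
  by apply: integral_ge0 => w _; exact: nneseries_ge0.
rewrite integral_nneseries // -nneseriesZl; last by move=> l _; rewrite lee_fin.
apply: lee_nneseries => [l _ _|l _]; first exact: integral_ge0.
rewrite ge0_integralZl_EFin // [X in (_ <= _ * X)%E]EFinM [leRHS]muleCA.
apply: lee_wpmul2l; first by rewrite lee_fin.
apply: (le_trans (integral_chain_resid_le t m (hu l))).
by rewrite -EFinM lee_fin sq_point tail_sum_point.
Qed.

(** The condition says that [k] has age [j]. On a decreasing path the age is unique, so this counts
    the times [k < n] of age at least [m], in a form whose expectation is computed term by term. *)
Definition long_ages m n w : nat := \sum_(0 <= k < n) \sum_(m <= j < k.+1)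
  ((M (k - j) w == 0) && (j <= M (k - j).+1 w)).

Lemma prob_long_run_le s' j :
  (\int[P]_w (((M s' w == 0) && (j <= M s'.+1 w))%N%:R : R)%:E <= (tail p j)%:E)%E.
Proof.
have [p0 _ _] := hp.
pose Z := [set w | M s' w = 0%N].
have mZ : measurable Z by apply: (adapted_measurable hM (@adapted_zero _ _ M s')).
have -> : (\int[P]_w (((M s' w == 0) && (j <= M s'.+1 w))%N%:R : R)%:E =
   \int[P]_(w in Z) (over j (fun=> 1 : R) (M s'.+1 w))%:E)%E.
  rewrite [RHS]integral_mkcond; apply: eq_integral => w _.
  rewrite /patch; case: ifPn => [/set_mem -> //|].
    by rewrite /over mulr1.
  by move=> /negP H; case: eqP => // H'; exfalso; apply: H; exact/mem_set.
rewrite (integral_next hp hM 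
  (Phi := fun _ y => (over j (fun=> 1 : R) y)%:E)); last 2 first.
- by move=> y w w'.
- by move=> w y; rewrite lee_fin mulr_ge0.
under eq_integral do under eq_eseriesr do rewrite -EFinM.
rewrite (over_sumE hp p3 j one_le_cube) -tailE integral_cst //.
rewrite -[leRHS]mule1 lee_pmul //.
  rewrite lee_fin tailE; apply: tail_sum_ge0 => //; exact: one_le_cube.
exact: probability_le1.
Qed.

(** The expected proportion is at most the sum of [tail p j] over [j >= m], which is summable in
    [m]. *)
Lemma ae_long_ages_small :
  {ae P, forall w, forall e : R, 0 < e -> exists m0, forall m, (m0 <= m)%N ->
    (long_ages m (2 ^ m) w)%:R / (2 ^ m)%N%:R <= e}.
Proof.
have t0 j : 0 <= tail p j.
  by rewrite tailE; apply: (tail_sum_ge0 hp p3) => l; exact: one_le_cube.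
pose b k j w : R := ((M (k - j) w == 0) && (j <= M (k - j).+1 w))%N%:R.
have b0 k j w : 0 <= b k j w by [].
have mb k j : measurable_fun setT (fun w => (b k j w)%:E).
  apply: (@adapted_measurable_fun _ _ _ _ _ _ hM _ _ (k - j).+1) => w w' H.
  by rewrite /b !H.
pose F m w := (\sum_(0 <= k < 2 ^ m) \sum_(m <= j < k.+1)
   (2 ^ m)%N%:R^-1%:E * (b k j w)%:E)%E.
have E m w : F m w = ((long_ages m (2 ^ m) w)%:R / (2 ^ m)%N%:R)%:E.
  rewrite /F /long_ages natr_sum mulr_suml -sumEFin; apply: eq_bigr => k _.
  by rewrite natr_sum mulr_suml -sumEFin; apply: eq_bigr => j _; rewrite mulrC EFinM.
have := @ae_summable_small _ _ _ P F.
move=> H; apply: filterS (H _ _ _).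
- by move=> w Hw e e0; have [m0 Hm] := Hw e e0; exists m0 => m /Hm; rewrite E lee_fin.
- move=> m; apply: emeasurable_sum => k; apply: emeasurable_sum => j.
  exact: measurable_funeM.
- by move=> m w; rewrite E lee_fin divr_ge0.
apply: le_lt_trans (summable_tails hp p3).
apply: lee_nneseries => [m _ _|m _].
  by apply: integral_ge0 => w _; rewrite E lee_fin divr_ge0.
have c0 : 0 <= ((2 ^ m)%N%:R^-1 : R) by rewrite invr_ge0.
rewrite /F ge0_integral_sum //; last 2 first.
- by move=> k; apply: emeasurable_sum => j; exact: measurable_funeM.
- by move=> k w _; apply: sume_ge0 => j _; apply: mule_ge0; rewrite lee_fin.
apply: (@le_trans _ _ (\sum_(0 <= k < 2 ^ m) (2 ^ m)%N%:R^-1%:E *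
    \sum_(0 <= j <oo) ((m <= j)%N%:R * tail p j)%:E)%E).
  apply: lee_sum => k _; rewrite ge0_integral_sum //; last 2 first.
  - by move=> j; exact: measurable_funeM.
  - by move=> j w _; apply: mule_ge0; rewrite lee_fin.
  rewrite -nneseriesZl; last by move=> j _; rewrite lee_fin mulr_ge0.
  apply: (@le_trans _ _ (\sum_(0 <= j < k.+1)
      (2 ^ m)%N%:R^-1%:E * ((m <= j)%N%:R * tail p j)%:E)%E); last first.
    by apply: nneseries_lim_ge => j _ _; rewrite -EFinM lee_fin !mulr_ge0.
  rewrite (big_nat_widenl m 0) //= big_mkcond /=; apply: lee_sum => j _.
  case: (m <= j)%N; last by rewrite mul0r mule0.
  rewrite mul1r ge0_integralZl_EFin //; last by move=> w _; rewrite lee_fin.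
  by apply: lee_wpmul2l; [rewrite lee_fin|exact: prob_long_run_le].
set S := (limn _).
apply: (@le_trans _ _ ((\sum_(0 <= k < 2 ^ m) ((2 ^ m)%N%:R^-1 : R)%:E) * S)%E).
  by rewrite ge0_sume_distrl // => k _; rewrite lee_fin.
rewrite sumEFin (_ : \sum_(0 <= k < 2 ^ m) _ = 1) ?mul1e //.
rewrite (sumr_const_nat (2 ^ m) 0) subn0 -[LHS]mulr_natl mulfV //.
Qed.

End almost_sure_bounds.

(** * The conditional mean *)

(** A positive value cannot be the default of [natmax], so it is a genuine maximum. *)
Lemma natmaxS_iff (A : set nat) l : natmax A = l.+1 <->
  A l.+1 /\ forall k, A k -> (k <= l.+1)%N.
Proof.
split=> [|[Al Amax]]; last exact: natmax_eq.
by rewrite /natmax; case: xgetP => // m -> [Am Amax] <-.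
Qed.

Lemma sigmaS_iff (x : nat -> nat) n l : sigma x n = l.+1 <->
  (forall j, (n < j <= n + l.+1)%N -> x j = 1%N) /\ x (n + l.+2)%N <> 1%N.
Proof.
split=> [/natmaxS_iff[/= H Hmax]|[H1 H2]].
  split=> // x1; suff /Hmax : forall j, (n < j <= n + l.+2)%N -> x j = 1%N.
    by rewrite ltnn.
  move=> j /andP[nj]; rewrite addnS leq_eqVlt ltnS => /orP[/eqP ->|jn].
    by rewrite -addnS.
  by apply: H; rewrite nj.
apply/natmaxS_iff; split=> //= k Hk; rewrite leqNgt; apply/negP => lk.
by apply: H2; apply: Hk; lia.
Qed.

Section conditional_mean.
Context {R : realType} {d} {T : measurableType d} (P : probability T R).
Variables (p : nat -> R) (M X : nat -> T -> nat).
Hypothesis hM : stationary_renewal_chain P p M.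
Hypothesis XE : forall n w, X n w = if M n w == 0%N then 0%N else 1%N.

Lemma adapted_X n : adapted M n (X n).
Proof. by move=> w w' H; rewrite !XE H. Qed.

Lemma measurable_sigma n (Y : set nat) :
  measurable [set w | Y (sigma (X ^~ w) n)].
Proof.
have mS l : measurable [set w | sigma (X ^~ w) n = l.+1].
  apply: (@adapted_measurable _ _ _ _ _ _ hM (n + l.+2)) => w w' H.
  have XX j : (j <= n + l.+2)%N -> X j w = X j w'.
    by move=> jn; apply: adapted_X => i ij; apply: H; lia.
  rewrite /mkset; apply/propext; rewrite !sigmaS_iff XX //.
  by split=> -[H1 H2]; split=> // j jn; move: (H1 j jn); rewrite XX //; lia.
have m1 l : measurable [set w | sigma (X ^~ w) n = l].
  (* The value 0, which includes the default on an infinite run, is the complement of all positive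
     values; each of those depends on finitely many coordinates. *)
  case: l => [|l] //.
  rewrite (_ : mkset _ = ~` \bigcup_l [set w | sigma (X ^~ w) n = l.+1]).
    by apply: measurableC; exact: bigcup_measurable.
  apply/seteqP; split=> [w /= E [l _ /=]|w /= H]; first by rewrite E.
  by case E : (sigma (X ^~ w) n) => [//|l]; exfalso; apply: H; exists l.
rewrite (_ : mkset _ = \bigcup_(l in Y) [set w | sigma (X ^~ w) n = l]).
  exact: bigcup_measurable.
by apply/seteqP; split=> [w Yw|w [l Yl /= ->]] //; exists (sigma (X ^~ w) n).
Qed.

Definition same_obs n (w w' : T) := forall i, (i <= n)%N -> X i w = X i w'.

(** The sets with this property form a sigma-algebra that contains the generators. *)
Lemma history_saturated n B : history X n B ->
  forall w w', same_obs n w w' -> B w -> B w'.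
Proof.
pose S : set (set T) := [set B | forall w w', same_obs n w w' -> B w -> B w'].
suff : history X n `<=` S by exact.
apply: smallest_sub => /=.
  split=> [//|C SC w w' H [_ nC]|F SF w w' H [k _ Fk]].
    by split=> // Cw'; apply: nC; apply: SC Cw' => i ni; rewrite H.
  by exists k => //; exact: SF Fk.
by move=> _ [i [v [ni ->]]] w w' H /= <-; rewrite H.
Qed.

Lemma history_atom n w0 : history X n [set w | same_obs n w0 w].
Proof.
pose G := [set A | exists i v, (i <= n)%N /\ A = [set w | X i w = v]].
rewrite (_ : mkset _ = \bigcap_(i in `I_n.+1) [set w | X i w = X i w0]).
  apply: (@bigcap_measurableType _ (g_sigma_algebraType G)) => i /= ni.
  by apply: sub_sigma_algebra; exists i, (X i w0).
by apply/seteqP; split=> w H i /= ni; rewrite (H i ni).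
Qed.

Lemma adapted_obs n w0 : adapted M n [set w | same_obs n w0 w].
Proof.
move=> w w' H; apply/propext; split=> H' i ni; rewrite H' //.
  by apply: adapted_X => j ji; rewrite H // (leq_trans ji).
by apply/esym/adapted_X => j ji; rewrite H // (leq_trans ji).
Qed.

Hypothesis hp : run_length_distribution p.
Hypothesis p3 : (\sum_(0 <= y <oo) (y.+1%:R ^+ 3 * p y)%:E < +oo)%E.

(** * Conditional mean on one atom of the observed past whose last zero is at [n - t] *)

Section atom.
Variables (n t : nat) (w0 : T).
Hypotheses (tn : (t <= n)%N) (zero : X (n - t)%N w0 = 0%N)
  (ones : forall i, (n - t < i <= n)%N -> X i w0 = 1%N).

Let s := (n - t)%N.
Let A := [set w | same_obs n w0 w].
Let B := [set w | same_obs s w0 w].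
Let Z := [set w | M s w = 0%N].

(** The observations after [s] are all ones, so they carry the single information that the run
    following the zero at [s] has length at least [t]. *)
Lemma mem_atom w : (forall n i, M n w = i.+1 -> M n.+1 w = i) ->
  A w <-> [/\ B w, Z w & (t <= M s.+1 w)%N].
Proof.
move=> Mdecr; have st : (s + t)%N = n by rewrite /s subnK.
have xE : forall n, (X ^~ w) n = if (M ^~ w) n == 0%N then 0%N else 1%N by [].
have run := run_after_zero xE Mdecr s t; rewrite st in run.
split=> [Aw|[Bw Zw /run H] i ni].
  split; first by move=> i si; apply: Aw; rewrite /s in si; lia.
    by apply/(x_eq0 xE); rewrite -(Aw s) // leq_subr.
  by apply/run => i si; rewrite -(Aw i) ?ones //; case/andP: si.
have [si|si] := leqP i s; first exact: Bw.
by rewrite ones ?si // H // si.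
Qed.

(** On the atom [sigma] at [n] is [M s.+1 - t], so the Markov property at the zero [s] separates the
    past [B] from the next run. *)
Lemma integral_atom (u : nat -> R) : (forall l, 0 <= u l <= l.+1%:R ^+ 3) ->
  (\int[P]_(w in A) (u (sigma (X ^~ w) n))%:E =
   (tail_sum p t u)%:E * \int[P]_(w in Z) (\1_B w)%:E)%E.
Proof.
move=> hu; have [p0 _ _] := hp.
have u0 l : 0 <= u l by case/andP: (hu l).
have st : (s + t)%N = n by rewrite /s subnK.
have mA : measurable A := adapted_measurable hM (@adapted_obs n w0).
have aB := @adapted_obs s w0.
have mB : measurable B := adapted_measurable hM aB.
have mZ : measurable Z := adapted_measurable hM (@adapted_zero _ _ M s).
pose F w y := (\1_B w * over t u y)%:E.
have F0 w y : (0 <= F w y)%E by rewrite lee_fin !mulr_ge0.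
have aF y : adapted M s (F ^~ y).
  move=> w w' H; rewrite /F /indic.
  suff -> : (w \in B) = (w' \in B) by [].
  have E : B w = B w' := aB _ _ H.
  by apply/idP/idP => /set_mem; [rewrite E|rewrite -E] => /mem_set.
transitivity (\int[P]_(w in Z) F w (M s.+1 w))%E.
  (* The integrands agree only almost surely, since [mem_atom] needs a decreasing path. *)
  rewrite integral_mkcond [RHS]integral_mkcond; apply: ge0_ae_eq_integral => //.
  - apply/(measurable_restrictT _ mA) => _ Y mY.
    by apply: measurableI => //; exact: (measurable_sigma n [set l | Y (u l)%:E]).
  - apply/(measurable_restrictT _ mZ)/measurable_funTS.
    apply: (@adapted_measurable_fun _ _ _ _ _ _ hM _ _ s.+1) => w w' H.
    by rewrite H //; apply: aF => i si; apply: H; lia.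
  - by move=> w _; apply: erestrict_ge0 => w' _; rewrite lee_fin.
  - by move=> w _; apply: erestrict_ge0 => w' _.
  apply: filterS (ae_decr hM) => w Mdecr _.
  have xE : forall n, (X ^~ w) n = if (M ^~ w) n == 0%N then 0%N else 1%N by [].
  have := mem_atom Mdecr; rewrite /patch => -[AB BA].
  case: ifPn => [/set_mem Aw|/negP nA].
    have [Bw Zw tM] := AB Aw.
    rewrite mem_set // /F /over tM mul1r indicE mem_set // mul1r.
    congr (u _)%:E; rewrite (sigmaE xE Mdecr) -st -addSn.
    exact: (path_decr (M := M ^~ w)).
  case: ifPn => // /set_mem Zw; rewrite /F /over indicE.
  case: (boolP (w \in B)) => [/set_mem Bw|_]; last by rewrite mul0r.
  case: leqP => tM; last by rewrite mul0r mulr0.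
  by exfalso; apply: nA; apply: mem_set; apply: BA.
rewrite (integral_next hp hM aF F0).
under eq_integral.
  move=> w _.
  under eq_eseriesr do rewrite -EFinM mulrCA EFinM.
  rewrite nneseriesZl; last by move=> y _; rewrite lee_fin !mulr_ge0.
  rewrite over_sumE // muleC.
  over.
rewrite ge0_integralZl_EFin //.
- by apply/measurable_funTS/measurable_EFinP; exact: measurable_indic.
- exact: tail_sum_ge0.
Qed.

(** A version of the conditional expectation is constant on an atom. Its value is the quotient of
    [integral_atom] for the identity by the same formula for the constant 1, where the common factor
    cancels. *)
Lemma cond_expectation_atom (Y : T -> R) :
  is_cond_expectation P (history X n) (fun w => (sigma (X ^~ w) n)%:R) Y ->
  P A != 0%E -> forall w, A w ->
  Y w = tail_sum p t (fun l => l%:R) / tail p t.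
Proof.
move=> [mY _ intY] PA0 w Aw.
have mA : measurable A := adapted_measurable hM (@adapted_obs n w0).
have mZ : measurable Z := adapted_measurable hM (@adapted_zero _ _ M s).
have mB : measurable B := adapted_measurable hM (@adapted_obs s w0).
have Yc w' : A w' -> Y w' = Y w.
  move=> Aw'; have hB := mY [set Y w] (measurable_set1 _).
  apply: (history_saturated hB (w := w)) => // i ni.
  by rewrite -(Aw i ni) (Aw' i ni).
have hu l : 0 <= (l%:R : R) <= l.+1%:R ^+ 3.
  rewrite ler0n /= -natrX ler_nat; apply: (@leq_trans l.+1) => //.
  by rewrite -[leqLHS]expn1 leq_pexp2l.
have := intY A (@history_atom n w0).
rewrite (integral_atom hu).
rewrite (eq_integral (cst (Y w)%:E)); last by move=> w' /set_mem /Yc ->.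
rewrite integral_cst //.
have := integral_atom one_le_cube; rewrite integral_cst // mul1e => PAE.
rewrite -tailE in PAE; rewrite PAE.
set q := (\int[P]_(w in Z) _)%E.
have qfin : q \is a fin_num.
  rewrite ge0_fin_numE; last by apply: integral_ge0 => w' _; rewrite lee_fin.
  rewrite /q integral_indic //.
  by rewrite (le_lt_trans (probability_le1 _ _)) ?ltry //; exact: measurableI.
rewrite -(fineK qfin) -!EFinM => H0.
have H := EFin_inj H0.
have : tail p t * fine q != 0.
  apply/negP => /eqP E0; move/eqP: PA0; apply; apply: (etrans PAE).
  by rewrite -/q -(fineK qfin) -EFinM E0.
rewrite mulf_eq0 negb_or => /andP[t0 q0].
apply: (mulIf t0); rewrite divfK //; apply: (mulIf q0).
by rewrite -mulrA.
Qed.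

End atom.

(** There are countably many observed pasts; null atoms are discarded and each of the others is
    handled by [cond_expectation_atom]. *)
Lemma ae_cond_mean (theta : nat -> T -> R) :
  (forall n, is_cond_expectation P (history X n)
       (fun w => (sigma (X ^~ w) n)%:R) (theta n)) ->
  {ae P, forall w, forall n, (psi (X ^~ w) <= n)%N ->
     theta n w = tail_sum p (tau (X ^~ w) n) (fun l => l%:R) /
                 tail p (tau (X ^~ w) n)}.
Proof.
move=> htheta; apply: ae_foralln => n.
pose code w := pickle [seq X i w | i <- iota 0 n.+1].
have codeP w w' : code w = code w' <-> same_obs n w w'.
  rewrite /code; split=> [/(pcan_inj pickleK)/eq_in_map H i ni|H].
    by apply: H; rewrite mem_iota; lia.
  by congr pickle; apply/eq_in_map => i; rewrite mem_iota => ?; apply: H; lia.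
suff H k : {ae P, forall w, code w = k -> (psi (X ^~ w) <= n)%N ->
     theta n w = tail_sum p (tau (X ^~ w) n) (fun l => l%:R) /
                 tail p (tau (X ^~ w) n)}.
  by apply: filterS (ae_foralln H) => w /(_ _ erefl).
have [[w0 [w0k Mdecr0 psi0]]|H] := pselect (exists w0, [/\ code w0 = k,
    forall n i, M n w0 = i.+1 -> M n.+1 w0 = i & (psi (X ^~ w0) <= n)%N]); last first.
  apply: filterS (ae_decr hM) => w Mdecr wk pn.
  by exfalso; apply: H; exists w.
have xE w m : (X ^~ w) m = if (M ^~ w) m == 0%N then 0%N else 1%N by exact: XE.
have := tauP (xE w0) Mdecr0 psi0; set t := tau _ n.
move=> /(tau_specP (xE w0) Mdecr0) [tn zero ones].
have tauA w : (forall n i, M n w = i.+1 -> M n.+1 w = i) -> same_obs n w0 w ->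
    tau (X ^~ w) n = t.
  move=> Mdecr ww0; apply: (tau_eq (xE w) Mdecr).
  apply/(tau_specP (xE w) Mdecr); split=> //.
    by rewrite -ww0 // leq_subr.
  by move=> i /andP[ti ni]; rewrite -ww0 // ones // ti.
have mA : measurable [set w | same_obs n w0 w].
  by apply: (adapted_measurable hM (n := n)); exact: adapted_obs.
have [PA|PA] := eqVneq (P [set w | same_obs n w0 w]) 0%E.
  exists [set w | same_obs n w0 w]; split=> // w /= /not_implyP[wk _].
  by apply/codeP; rewrite wk.
apply: filterS (ae_decr hM) => w Mdecr wk _.
have ww0 : same_obs n w0 w by apply/codeP; rewrite wk.
rewrite (tauA w Mdecr ww0).
exact: (cond_expectation_atom tn zero ones (htheta n) PA ww0).
Qed.

End conditional_mean.

(** * Selected times and estimation errors *)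

(** The partial sums telescope once the remainder [1 / (n + 1)] is added to them. *)
Lemma nneseries_inv_sqr_le (R : realType) :
  (\sum_(0 <= l <oo) ((l.+1%:R ^+ 2)^-1 : R)%:E <= 2%:E)%E.
Proof.
have H n : \sum_(0 <= l < n.+1) (l.+1%:R ^+ 2)^-1 + n.+1%:R^-1 <= 2 :> R.
  elim: n => [|n IH]; first by rewrite big_nat1 expr1n invr1.
  rewrite big_nat_recr //=; apply: le_trans IH.
  rewrite -addrA lerD2l.
  have a0 : (0 : R) < n.+1%:R by rewrite ltr0n.
  rewrite -[n.+2%:R]natr1; set a : R := n.+1%:R in a0 *.
  have b0 : 0 < a + 1 by rewrite addr_gt0.
  rewrite -subr_ge0.
  have -> : a^-1 - (((a + 1) ^+ 2)^-1 + (a + 1)^-1) = (a * (a + 1) ^+ 2)^-1.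
    by field; rewrite !gt_eqF.
  by rewrite invr_ge0 mulr_ge0 ?exprn_ge0 // ltW.
apply: lime_le.
  by apply: is_cvg_nneseries => l _ _; rewrite lee_fin invr_ge0 exprn_ge0.
apply: nearW => n; rewrite sumEFin lee_fin.
apply: (@le_trans _ _ (\sum_(0 <= l < n.+1) (l.+1%:R ^+ 2)^-1)).
  by rewrite big_nat_recr //= lerDl invr_ge0 exprn_ge0.
by apply: le_trans (H n); rewrite lerDl invr_ge0.
Qed.

Lemma powR2_lt1 (R : realType) (a : R) : a < 0 -> 2 `^ a < 1.
Proof.
move=> a0; rewrite -[a]opprK powRN invf_lt1 ?powR_gt0 //.
rewrite [ltLHS](_ : _ = 1 `^ (- a)); last by rewrite powR1.
by apply: gt0_ltr_powR; rewrite ?nnegrE ?oppr_gt0 // ltr1n.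
Qed.

Lemma nnereal_cvg0 (R : realType) (f : nat -> \bar R) : (forall n, 0 <= f n)%E ->
  (forall e : R, 0 < e -> exists n0, forall n, (n0 <= n)%N -> (f n <= e%:E)%E) ->
  f @ \oo --> (0%:E : \bar R).
Proof.
move=> f0 fe.
have fin n (e : R) : (f n <= e%:E)%E -> f n \is a fin_num.
  by move=> fne; rewrite ge0_fin_numE //; apply: le_lt_trans fne (ltry _).
apply/fine_cvgP; split.
  by have [n0 H] := fe 1 ltr01; exists n0 => // n /= /H; exact: fin.
apply/cvgrPdist_le => e e0; have [n0 H] := fe e e0; exists n0 => // n /= /H fne.
rewrite sub0r normrN ger0_norm ?fine_ge0 // -lee_fin fineK //; exact: fin fne.
Qed.

Lemma nnreal_cvg0 (R : realType) (f : nat -> R) : (forall n, 0 <= f n) ->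
  (forall e : R, 0 < e -> exists n0, forall n, (n0 <= n)%N -> f n <= e) ->
  f @ \oo --> (0 : R).
Proof.
move=> f0 fe; apply/cvgrPdist_le => e e0; have [n0 H] := fe e e0.
by exists n0 => // n /= /H fne; rewrite sub0r normrN ger0_norm.
Qed.

Section path_estimates.
Context {R : realType} {d} {T : measurableType d}.
Variables (M X : nat -> T -> nat) (w : T) (gamma : R).
Hypothesis XE : forall n w, X n w = if M n w == 0%N then 0%N else 1%N.
Hypothesis Mdecr : forall n i, M n w = i.+1 -> M n.+1 w = i.
Hypotheses (gamma0 : 0 < gamma) (gamma1 : gamma < 1).

Local Notation x := (X ^~ w).
Local Notation lam := (lambda gamma x).
Let xE : forall n, (X ^~ w) n = if (M ^~ w) n == 0%N then 0%N else 1%N.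
Proof. by []. Qed.

Definition pow_scale m : R := (2 ^ m)%N%:R `^ (1 - gamma).

Lemma pow_scale_gt0 m : 0 < pow_scale m.
Proof. by rewrite powR_gt0 // ltr0n expn_gt0. Qed.

Lemma powR2_nat (a : R) m : (2 ^ m)%N%:R `^ a = (2 `^ a) ^+ m.
Proof.
rewrite natrX -powR_mulrn // -powRrM mulrC powRrM powR_mulrn //.
Qed.

(** The lost factor is [2 ^ (1 - gamma)], at most 2. *)
Lemma scale_powR L m : (0 < L)%N -> (2 ^ m <= L.*2)%N ->
  pow_scale m / 2 <= L%:R `^ (1 - gamma).
Proof.
move=> L0 mL.
have g0 : 0 <= 1 - gamma by rewrite subr_ge0 ltW.
apply: (@le_trans _ _ ((2 * L%:R) `^ (1 - gamma) / 2)).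
  rewrite ler_wpM2r ?invr_ge0 //; apply: ge0_ler_powR => //; rewrite ?nnegrE //.
  by rewrite -natrM ler_nat mul2n.
rewrite powRM // ler_pdivrMr // mulrC ler_wpM2l ?powR_ge0 //.
rewrite -[leRHS]powRr1 // ler_powR ?ler1n // lerBlDr lerDl ltW //.
Qed.

(** * Density of the selected times and the limit of [lambda n / n] *)

Definition good k := (k%:R `^ (1 - gamma) <= (tau_matches x (psi x) k)%:R :> R).

Definition nbad n : nat := \sum_(psi x <= k < n) ~~ good k.

(** All earlier bad times of age [t] are matches of the last one, which being bad has fewer than
    [N ^ (1 - gamma)] matches. *)
Lemma nbad_age_le N t n : (n <= N)%N ->
  (\sum_(psi x <= k < n) (~~ good k && (tau x k == t)))%N%:R <=
  N%:R `^ (1 - gamma) + 1 :> R.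
Proof.
have g0 : 0 <= 1 - gamma by rewrite subr_ge0 ltW.
elim: n => [|n IH] nN; first by rewrite big_geq // addr_ge0 ?powR_ge0.
have [np|pn] := ltnP n (psi x); first by rewrite big_geq // addr_ge0 ?powR_ge0.
rewrite big_nat_recr //=; case: andP => [[bad /eqP tn]|_]; last first.
  by rewrite addn0; apply: IH; exact: ltnW.
rewrite addn1 -natr1 lerD2r.
apply: (@le_trans _ _ (tau_matches x (psi x) n)%:R).
  rewrite ler_nat /tau_matches [leqRHS]big_mkcond /= big_nat [leqRHS]big_nat.
  apply: leq_sum => k /andP[pk _]; rewrite pk tn /=.
  by case: (tau x k == t); rewrite ?andbT ?andbF // leq_b1.
rewrite /good -ltNge in bad; apply: (le_trans (ltW bad)).
by apply: ge0_ler_powR; rewrite ?nnegrE // ler_nat ltnW.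
Qed.

Lemma nbad_dyadic_le m :
  (nbad (2 ^ m))%:R <= m%:R * (pow_scale m + 1) + (long_ages M m (2 ^ m) w)%:R :> R.
Proof.
apply: (@le_trans _ _ ((\sum_(0 <= t < m) \sum_(psi x <= k < 2 ^ m)
    (~~ good k && (tau x k == t)) + long_ages M m (2 ^ m) w)%N%:R)).
  rewrite ler_nat exchange_big /= /nbad /long_ages.
  apply: (@leq_trans (\sum_(psi x <= k < 2 ^ m)
    (\sum_(0 <= t < m) (~~ good k && (tau x k == t)) +
     \sum_(m <= j < k.+1) ((M (k - j) w == 0) && (j <= M (k - j).+1 w))))%N).
    rewrite big_nat [leqRHS]big_nat; apply: leq_sum => k /andP[pk _].
    have /and3P[tk Mt tM] := tauP xE Mdecr pk.
    (* A bad [k] is counted at the index [tau x k]: in the first sum for a short age, in the second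
       otherwise. *)
    have [tm|mt] := ltnP (tau x k) m.
      rewrite (bigD1_seq (tau x k)) ?mem_index_iota ?iota_uniq //= eqxx andbT.
      by rewrite -addnA leq_addr.
    rewrite [X in (_ <= _ + X)%N](bigD1_seq (tau x k)) ?iota_uniq //=; last first.
      by rewrite mem_index_iota mt ltnS.
    rewrite Mt tM /= addnCA; apply: leq_trans (leq_addr _ _); exact: leq_b1.
  rewrite big_split /= leq_add2l.
  have [pm|mp] := leqP (psi x) (2 ^ m); last by rewrite big_geq // ltnW.
  by rewrite [leqRHS](big_cat_nat (n := psi x)) //= leq_addl.
rewrite natrD lerD2r natr_sum.
apply: (@le_trans _ _ (\sum_(0 <= t < m) (pow_scale m + 1))).
  by apply: ler_sum => t _; exact: nbad_age_le.
by rewrite sumr_const_nat subn0 mulr_natl.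
Qed.

Hypothesis ages_small : forall e : R, 0 < e -> exists m0, forall m, (m0 <= m)%N ->
  (long_ages M m (2 ^ m) w)%:R / (2 ^ m)%N%:R <= e.

Lemma dyadic_bound n : (0 < n)%N -> exists m, (n < 2 ^ m)%N /\ (2 ^ m <= n.*2)%N.
Proof.
move=> n0; exists (trunc_log 2 n).+1; have := trunc_log_bounds (isT : (1 < 2)%N) n0.
by move=> /andP[H ->]; rewrite expnS -mul2n leq_pmul2l.
Qed.

Lemma nbad_mono n n' : (n <= n')%N -> (nbad n <= nbad n')%N.
Proof.
move=> nn; rewrite /nbad; have [pn|np] := leqP (psi x) n; last first.
  by rewrite big_geq // ltnW.
by rewrite [leqRHS](big_cat_nat (n := n)) //= leq_addr.
Qed.

Lemma nbad_density (e : R) : 0 < e ->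
  exists N0, forall N, (N0 <= N)%N -> (nbad N)%:R <= e * N%:R.
Proof.
move=> e0; pose z : R := 2 `^ (- gamma).
have z0 : 0 < z by rewrite powR_gt0.
have z1 : z < 1.
  by rewrite powR2_lt1 // oppr_lt0.
(* Short ages cost [2 * (e / 8) * 2 ^ m] and long ages [e / 4 * 2 ^ m], in total [e / 2 * 2 ^ m], at
   most [e * N] because [2 ^ m <= 2 N]. *)
have e8 : 0 < e / 8 by rewrite divr_gt0.
have [m1 H1] := mul_geometric_small z0 z1 e8.
have [m2 H2] := ages_small (e := e / 4) (ltac:(by rewrite divr_gt0)).
exists (2 ^ (maxn m1 m2))%N => N N0.
have Np : (0 < N)%N by apply: leq_trans N0; rewrite expn_gt0.
have [m [Nm mN]] := dyadic_bound Np.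
have : (maxn m1 m2 < m)%N by rewrite -(@ltn_exp2l 2) //; exact: leq_ltn_trans Nm.
rewrite gtn_max => /andP[/ltnW/H1 h1 /ltnW/H2 h2].
have N2 : 0 < (2 ^ m)%N%:R :> R by rewrite ltr0n expn_gt0.
apply: (@le_trans _ _ (nbad (2 ^ m))%:R); first by rewrite ler_nat nbad_mono // ltnW.
apply: (le_trans (nbad_dyadic_le m)).
apply: (@le_trans _ _ (e / 2 * (2 ^ m)%N%:R)); last first.
  rewrite -mulrA ler_wpM2l ?(ltW e0) // mulrC ler_pdivrMr // -natrM ler_nat.
  by rewrite muln2.
rewrite ler_pdivrMr // in h2.
have scaleE : pow_scale m = (2 ^ m)%N%:R * z ^+ m.
  rewrite /pow_scale /z powRD; last by rewrite pnatr_eq0 expn_eq0 implybT.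
  by rewrite powRr1 // powR2_nat.
have one_le : 1 <= pow_scale m.
  rewrite /pow_scale -[leLHS](powRr0 (2 ^ m)%N%:R); apply: ler_powR.
    by rewrite ler1n expn_gt0.
  by rewrite subr_ge0 ltW.
have : m%:R * (pow_scale m + 1) <= 2 * (m.+1%:R * z ^+ m) * (2 ^ m)%N%:R.
  have -> : 2 * (m.+1%:R * z ^+ m) * (2 ^ m)%N%:R = m.+1%:R * (2 * pow_scale m).
    by rewrite scaleE; ring.
  apply: ler_pM => //; first by rewrite addr_ge0 // ltW // pow_scale_gt0.
    by rewrite ler_nat.
  by rewrite mulr_natl mulr2n lerD2l.
have := ler_wpM2r (ltW N2) h1; move: h2.
set A := (long_ages _ _ _ _)%:R; set B := _ * (_ + 1); set C := _ * z ^+ m.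
set D := (2 ^ m)%N%:R; nra.
Qed.

(** Otherwise all times after [K] would be bad, and their density would exceed one half. *)
Lemma good_after K : (psi x <= K)%N -> exists2 k, (K < k)%N & good k.
Proof.
move=> pK; apply: contrapT => H.
have bad k : (K < k)%N -> ~~ good k.
  by move=> Kk; apply/negP => gk; apply: H; exists k.
have [N0 HN] := nbad_density (e := 2^-1) (ltac:(by rewrite invr_gt0)).
pose N := maxn N0 (K.+1.*2).+1.
have := HN N (leq_maxl _ _); apply/negP; rewrite -ltNge.
rewrite -(ltr_pM2l (ltr0Sn R 1)) mulrA mulfV ?mul1r ?pnatr_eq0 // -natrM ltr_nat.
apply: (@leq_trans (2 * (N - K.+1))%N); last first.
  rewrite leq_mul2l /= /nbad (big_cat_nat (n := K.+1)) //=; last 2 first.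
  - exact: leqW.
  - by rewrite /N; lia.
  apply: leq_trans (leq_addl _ _).
  rewrite -[leqLHS]muln1 -sum_nat_const_nat big_nat [leqRHS]big_nat.
  by apply: leq_sum => k /andP[Kk _]; rewrite bad.
rewrite /N; lia.
Qed.

(** By [good_after], the set minimised in [lambda] is nonempty, so the default of [natmin] never
    occurs. *)
Lemma lambda_spec n : (psi x <= lam n)%N /\
  [/\ (lam n < lam n.+1)%N, good (lam n.+1) &
    forall k, (lam n < k < lam n.+1)%N -> ~~ good k].
Proof.
have step m : (psi x <= lam m)%N ->
    [/\ (lam m < lam m.+1)%N, good (lam m.+1) &
    forall k, (lam m < k < lam m.+1)%N -> ~~ good k].
  move=> pm; have [k lk gk] := good_after pm.
  have := @natminP [set k | (lam m < k)%N /\ good k].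
  case; first by exists k.
  rewrite -[natmin _]/(lam m.+1) => -[H1 H2] H3; split=> //.
  move=> j /andP[mj jm]; apply/negP => gj.
  by have := H3 j (conj mj gj); rewrite leqNgt jm.
suff H m : (psi x <= lam m)%N by split=> //; exact: step.
elim: m => [//|m IH]; have [H _ _] := step m IH.
by apply: (leq_trans IH); exact: ltnW.
Qed.

(** Between consecutive selected times all times are bad, so [lam n] exceeds [psi x + n] by at most
    the number of bad times passed over. *)
Lemma lambda_bounds n : (n <= lam n)%N /\
  (lam n <= psi x + n + nbad (lam n))%N.
Proof.
elim: n => [|n [IH1 IH2]]; first by rewrite /= addn0 leq_addr.
have [pl [ll _ bad]] := lambda_spec n.
split; first exact: leq_ltn_trans ll.
set l' := lam n.+1 in ll bad *; set l := lam n in IH1 IH2 pl ll bad.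
have : (nbad l + (l' - l.+1) <= nbad l')%N.
  rewrite /nbad [leqRHS](big_cat_nat (n := l.+1)) //=; last exact: leqW.
  rewrite [X in (_ <= X + _)%N]big_nat_recr //= -addnA leq_add2l.
  apply: leq_trans (leq_addl _ _).
  rewrite -[leqLHS]muln1 -sum_nat_const_nat big_nat [leqRHS]big_nat.
  by apply: leq_sum => k lk; rewrite bad.
lia.
Qed.

Lemma lambda_cvg : (fun n => (lam n)%:R / n%:R : R) @ \oo --> (1 : R).
Proof.
apply/cvgrPdist_le => e e0.
(* The bound 1/2 gives [lam n <= 2 (psi x + n)]; the bound [e / 4] then leaves a bad part of order
   [e / 2 * n], and [psi x] is absorbed for large [n]. *)
pose e' := Num.min 2^-1 (e / 4).
have e'0 : 0 < e' by rewrite lt_min invr_gt0 ltr0n /= divr_gt0.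
have [N0 HN] := nbad_density e'0.
near=> n.
have [l1 l2] := lambda_bounds n; set l := lam n in l1 l2 *.
have n0 : (0 : R) < n%:R by rewrite ltr0n; near: n; exact: nbhs_infty_gt.
have nN0 : (N0 <= n)%N by near: n; exact: nbhs_infty_ge.
have npsi : (psi x)%:R * 4 / e <= n%:R by near: n; exact: nbhs_infty_ger.
have := HN l (leq_trans nN0 l1).
have e'1 : e' <= 2^-1 by rewrite ge_min lexx.
have e'2 : e' <= e / 4 by rewrite ge_min lexx orbT.
move: l1 l2; rewrite -!(ler_nat R) !natrD => l1 l2 hb.
rewrite ler_pdivrMr // in npsi.
rewrite distrC ger0_norm; last by rewrite subr_ge0 ler_pdivlMr // mul1r.
rewrite lerBlDr ler_pdivrMr //.
move: (psi x)%:R (nbad l)%:R l%:R n%:R (ler0n R (psi x)) l1 l2 hb npsi n0.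
move=> a b c k a0; clear -e'0 e'1 e'2 e0 a0 => h1 h2 h3 h4 k0.
have h5 : c <= 2 * (a + k) by nra.
nra.
Unshelve. all: by end_near. Qed.

(** The window holds exactly [W] matches, so centring [u] by [c] costs [c * W], and [window_sum]
    makes the rest an increment of [walk]. The index [n.+1] is taken because [lam 0] is not a
    selected time. *)
Lemma window_spec n (t := tau x (lam n.+1)) : exists W : nat, [/\ (0 < W)%N,
  window gamma x n.+1 = W%:Z, (lam n.+1)%:R `^ (1 - gamma) <= W%:R :> R,
  (kappa gamma x n.+1 <= lam n.+1)%N &
  forall (u : nat -> R) (c : R), \sum_(kappa gamma x n.+1 <= i < lam n.+1)
      (tau x i == t)%:R * u (sigma x i) =
    c * W%:R + (walk M (over t (fun l => u l - c)) w (lam n.+1 - t) -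
                walk M (over t (fun l => u l - c)) w (kappa gamma x n.+1 - t))].
Proof.
have [pl [ll gd _]] := lambda_spec n.
set L := lam n.+1 in t ll gd *.
have L0 : (0 : R) < L%:R by rewrite ltr0n (leq_ltn_trans _ ll).
have v0 : 0 < L%:R `^ (1 - gamma) by rewrite powR_gt0.
pose W := `|window gamma x n.+1|%N.
have WE : window gamma x n.+1 = W%:Z.
  by rewrite /W gez0_abs // /window ltW // ceil_gt0.
have W0 : (0 < W)%N by rewrite -ltz_nat -WE /window ceil_gt0.
have WL : (W <= tau_matches x (psi x) L)%N.
  by rewrite -lez_nat -WE /window ceil_le_int.
have [K [KE pK KL tK mK]] := kappa_spec W0 WL.
have kE : kappa gamma x n.+1 = K by rewrite -KE /kappa WE.
exists W; rewrite kE; split=> //.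
- by have := ceil_ge (L%:R `^ (1 - gamma)); rewrite -/(window gamma x n.+1) WE.
- exact: ltnW.
move=> u c.
have -> : W%:R = \sum_(K <= i < L) (tau x i == t)%:R :> R.
  rewrite -mK /tau_matches natr_sum big_mkcond /= big_nat [RHS]big_nat.
  apply: eq_bigr => i /andP[Ki _]; rewrite (leq_trans pK Ki) /=.
  by case: (tau x i == tau x L).
have walkB a b : (a <= b)%N -> walk M (over t (fun l => u l - c)) w b -
    walk M (over t (fun l => u l - c)) w a =
    \sum_(a <= i < b) (M i w == 0%N)%:R * over t (fun l => u l - c) (M i.+1 w).
  by move=> ab; rewrite /walk (big_cat_nat (n := a)) //= addrAC subrr add0r.
rewrite walkB; last by rewrite leq_sub2r // ltnW.
have := window_sum xE Mdecr (fun l => u l - c) pK (ltnW KL) tK.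
rewrite -/t => <-; rewrite mulr_sumr -big_split /=.
by apply: eq_bigr => i _; ring.
Qed.

(** * Errors of the two estimators along a path *)

Variables (p : nat -> R) (s : R).
Hypotheses (s0 : 0 < s) (s1 : s < 1) (sE : s ^+ 3 = 2 `^ (gamma - 2^-1)).

Lemma pow_scale_rate m :
  ((s ^+ 3) ^+ m * pow_scale m) ^+ 2 = (2 ^ m)%N%:R.
Proof.
rewrite sE -powR2_nat /pow_scale -powRD; last first.
  by apply/implyP => _; rewrite pnatr_eq0 expn_eq0.
rewrite -powR_mulrn ?powR_ge0 // -powRrM.
have -> : (gamma - 2^-1 + (1 - gamma)) * 2%:R = 1 by field.
by rewrite powRr1.
Qed.

Lemma rate_pow_scale m :
  m.+1%:R / pow_scale m ^+ 2 = rate s m * (s ^+ 3) ^+ m.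
Proof.
have w0 := pow_scale_gt0 m; have b0 : 0 < (s ^+ 3) ^+ m by rewrite !exprn_gt0.
by rewrite /rate -(pow_scale_rate m); field; rewrite !gt_eqF.
Qed.

(** The error is a [walk] increment divided by [W]. In 16, one factor 4 comes from
    [sqr_incr_le_chain] and the other from squaring [W >= pow_scale m / 2]. *)
Lemma estimate_error n m (u : nat -> R) (t := tau x (lam n.+1)) :
  (lam n.+1 < 2 ^ m)%N -> (2 ^ m <= (lam n.+1).*2)%N ->
  (((window gamma x n.+1)%:~R)^-1 * \sum_(kappa gamma x n.+1 <= i < lam n.+1)
      (tau x i == t)%:R * u (sigma x i) - tail_sum p t u / tail p t) ^+ 2 <=
  16 * (rate s m * (s ^+ 3) ^+ m) * chain_sq (walk M (resid p t u) w) m 0.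
Proof.
move=> Lm mL; have [W [W0 WE LW kL sumE]] := window_spec n.
set L := lam n.+1 in t Lm mL LW kL sumE *.
set K := kappa _ _ _ in kL sumE *.
rewrite (sumE u (tail_sum p t u / tail p t)) WE -/(resid p t u).
set S := walk M (resid p t u) w; set c := _ / _.
have WR : (0 : R) < W%:R by rewrite ltr0n.
have -> : (W%:~R)^-1 * (c * W%:R + (S (L - t)%N - S (K - t)%N)) - c =
    (S (L - t)%N - S (K - t)%N) / W%:R :> R.
  by rewrite -[W%:~R]/(W%:R : R); field; rewrite gt_eqF.
have wm := pow_scale_gt0 m.
have L0 : (0 < L)%N by rewrite -double_gt0 (leq_trans _ mL) // expn_gt0.
have hW : pow_scale m / 2 <= W%:R by apply: le_trans LW; exact: scale_powR.
have hS : (S (L - t)%N - S (K - t)%N) ^+ 2 <= 4 * m.+1%:R * chain_sq S m 0.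
  by apply: sqr_incr_le_chain; lia.
rewrite -rate_pow_scale.
rewrite exprMn exprVn ler_pdivrMr ?exprn_gt0 //; apply: (le_trans hS).
have q0 := chain_sq_ge0 S m 0.
have -> : 16 * (m.+1%:R / pow_scale m ^+ 2) * chain_sq S m 0 * W%:R ^+ 2 =
   4 * m.+1%:R * chain_sq S m 0 * (2 * W%:R / pow_scale m) ^+ 2.
  by field; rewrite gt_eqF.
rewrite -[leLHS]mulr1; apply: ler_wpM2l; first by rewrite !mulr_ge0.
rewrite exprn_ege1 // ler_pdivlMr // mul1r.
by rewrite ler_pdivrMr // mulrC in hW.
Qed.

Lemma dyadic_scale m0 n : (2 ^ m0 <= n)%N -> exists m,
  [/\ (m0 <= m)%N, (lam n < 2 ^ m)%N & (2 ^ m <= (lam n).*2)%N].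
Proof.
move=> n0; have [ln _] := lambda_bounds n.
have l0 : (0 < lam n)%N by apply: leq_trans ln; apply: leq_trans n0; rewrite expn_gt0.
have [m [lm ml]] := dyadic_bound l0; exists m; split=> //.
apply: ltnW; rewrite -(@ltn_exp2l 2) //.
by apply: leq_ltn_trans lm; exact: leq_trans ln.
Qed.

Lemma scale_le1 m : (s ^+ 3) ^+ m <= 1.
Proof. by do ?[apply: exprn_ile1|apply: exprn_ge0|exact: ltW]. Qed.

Lemma h_est_cvg (theta : nat -> R) :
  (forall e : R, 0 < e -> exists m0, forall m, (m0 <= m)%N -> forall t,
    rate s m * chain_sq (walk M (resid p t (fun l => l%:R)) w) m 0 <= e) ->
  (forall n, (psi x <= n)%N ->
    theta n = tail_sum p (tau x n) (fun l => l%:R) / tail p (tau x n)) ->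
  (fun n => `|h_est gamma x n - theta (lam n)|) @ \oo --> (0 : R).
Proof.
move=> mean_small thetaE; apply: nnreal_cvg0 => // e e0.
(* The error is compared after squaring; 16 is the constant of [estimate_error], and the reserve
   factor [(s ^+ 3) ^+ m] is just bounded by 1. *)
have e16 : 0 < e ^+ 2 / 16 by rewrite divr_gt0 // exprn_gt0.
have [m0 Hm0] := mean_small _ e16.
exists (2 ^ m0)%N => -[|n] n0; first by move: n0; rewrite leqNgt expn_gt0.
have [m [m0m lm ml]] := dyadic_scale n0.
have [pl _] := lambda_spec n.+1.
rewrite thetaE //; have := estimate_error (fun l => l%:R) lm ml.
rewrite -/(h_est gamma x n.+1); set D := h_est _ _ _ - _ => hD.
rewrite -(ler_pXn2r (ltn0Sn 1)) ?nnegrE ?(ltW e0) // real_normK ?num_real //.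
apply: (le_trans hD); set t := tau _ _.
have := Hm0 m m0m t; set q := chain_sq _ _ _ => hq.
have q0 : 0 <= rate s m * q by rewrite mulr_ge0 ?rate_ge0 ?chain_sq_ge0.
have b0 : 0 <= (s ^+ 3) ^+ m by rewrite !exprn_ge0 // ltW.
have b1 := scale_le1 m; move: hq q0 b0 b1; rewrite ler_pdivlMr //.
set r := rate s m; set b := (s ^+ 3) ^+ m => hq q0 b0 b1.
have -> : 16 * (r * b) * q = r * q * 16 * b by ring.
by apply: le_trans hq; rewrite -[leRHS]mulr1 ler_wpM2l // mulr_ge0.
Qed.

(** Each absolute error is split as [eps + D^2 / eps] with [eps] proportional to [(l + t + 1)^-2].
    The first parts are summable in [l], and the second produce the weights of the hypothesis. The
    reserve factor [(s ^+ 3) ^+ m] makes [eps] small and cancels in [D^2 / eps]. *)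
Lemma p_est_cvg :
  (forall e : R, 0 < e -> exists m0, forall m, (m0 <= m)%N -> forall t,
    ((rate s m)%:E * \sum_(0 <= l <oo)
     ((l + t).+1%:R ^+ 2 *
       chain_sq (walk M (resid p t (fun k => (k == l)%:R)) w) m 0)%:E <= e%:E)%E) ->
  (fun n => \sum_(0 <= l <oo)
     (`|p_est gamma x n l - p (l + tau x (lam n))%N / tail p (tau x (lam n))|)%:E)%E
     @ \oo --> (0%:E : \bar R).
Proof.
move=> point_small; apply: nnereal_cvg0 => [n|e e0].
  by apply: nneseries_ge0 => l _ _; rewrite lee_fin.
(* The two halves of the bound are [e / 4 * 2], with 2 bounding the sum of inverse squares, and
   [16 * (e / 32)]. *)
have e4 : 0 < e / 4 by rewrite divr_gt0.
have e32 : 0 < e / 32 by rewrite divr_gt0.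
have [m1 Hm1] := point_small _ e32.
have s30 : 0 < s ^+ 3 by rewrite exprn_gt0.
have s31 : s ^+ 3 < 1 by rewrite exprn_ilt1 // ltW.
have [m2 Hm2] := mul_geometric_small s30 s31 e4.
exists (2 ^ (maxn m1 m2))%N => -[|n] n0; first by move: n0; rewrite leqNgt expn_gt0.
have [m [m0m lm ml]] := dyadic_scale n0.
move: m0m; rewrite geq_max => /andP[/Hm1 hm1 /Hm2 hm2].
set t := tau x _ in hm1 *.
pose q l := chain_sq (walk M (resid p t (fun k => (k == l)%:R)) w) m 0.
have q0 l : 0 <= q l := chain_sq_ge0 _ _ _.
have aq0 l : 0 <= (l + t).+1%:R ^+ 2 * q l by apply: mulr_ge0 => //; exact: exprn_ge0.
have r0 := rate_ge0 s0 m; set r := rate s m in hm1 r0 *.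
have b0 : 0 < (s ^+ 3) ^+ m by rewrite exprn_gt0.
have b1 : (s ^+ 3) ^+ m <= e / 4.
  apply: le_trans hm2; rewrite -[leLHS]mul1r ler_wpM2r ?(ltW b0) //.
  by rewrite ler1n.
apply: (@le_trans _ _ (\sum_(0 <= l <oo) ((e / 4)%:E * ((l.+1%:R ^+ 2)^-1)%:E +
    (16 * r)%:E * ((l + t).+1%:R ^+ 2 * q l)%:E))%E).
  apply: lee_nneseries => [l _ _|l _]; first by rewrite lee_fin.
  have -> : p_est gamma x n.+1 l = ((window gamma x n.+1)%:~R)^-1 *
      \sum_(kappa gamma x n.+1 <= i < lam n.+1)
      (tau x i == t)%:R * (sigma x i == l)%:R.
    by congr (_ * _); apply: eq_bigr => i _; rewrite -mulnb natrM.
  rewrite -tail_sum_point //.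
  have := estimate_error (fun k => (k == l)%:R) lm ml.
  rewrite -/t -/r -/(q l); set D := _ - _ => hD.
  rewrite -!EFinM -EFinD lee_fin.
  pose a : R := (l + t).+1%:R ^+ 2; pose b := (s ^+ 3) ^+ m.
  have a0 : 0 < a by rewrite exprn_gt0.
  have la : l.+1%:R ^+ 2 <= a by rewrite lerXn2r ?nnegrE // ler_nat ltnS leq_addr.
  (* |D| <= eps + D^2 / eps with eps = b / a *)
  have D1 : `|D| <= b / a + D ^+ 2 * (a / b).
    have z0 : 0 < b / a by rewrite divr_gt0.
    have -> : a / b = (b / a)^-1 by rewrite invf_div.
    rewrite -(ler_pM2l z0) -(real_normK (num_real D)).
    have := normr_ge0 D; move: (`|D|) => y y0; move: z0; move: (b / a) => z z0.
    have -> : z * (z + y ^+ 2 / z) = z ^+ 2 + y ^+ 2 by field; rewrite gt_eqF.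
    have := sqr_ge0 (z - y); nra.
  apply: (le_trans D1); apply: lerD.
    apply: ler_pM => //; [exact: ltW|by rewrite invr_ge0 ltW|].
    by rewrite lef_pV2 ?posrE ?exprn_gt0.
  apply: (@le_trans _ _ (16 * (r * b) * q l * (a / b))).
    by rewrite ler_wpM2r // divr_ge0 // ltW.
  rewrite le_eqVlt; apply/orP; left; apply/eqP; rewrite -/a.
  by field; rewrite gt_eqF.
rewrite nneseriesD; last 2 first.
- by move=> l _; rewrite -EFinM lee_fin mulr_ge0 ?invr_ge0 ?exprn_ge0 // ltW.
- by move=> l _ _; rewrite -EFinM lee_fin; apply: mulr_ge0 => //; exact: mulr_ge0.
rewrite nneseriesZl; last by move=> l _; rewrite lee_fin invr_ge0 exprn_ge0.
rewrite nneseriesZl; last by move=> l _; rewrite lee_fin.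
rewrite [leRHS](_ : _ = (e / 4 * 2 + 16 * (e / 32))%:E); last by congr EFin; field.
rewrite EFinD; apply: leeD.
  rewrite [(e / 4 * 2)%:E]EFinM; apply: lee_wpmul2l; first by rewrite lee_fin ltW.
  exact: nneseries_inv_sqr_le.
rewrite [(16 * r)%:E]EFinM [(16 * (e / 32))%:E]EFinM -muleA.
apply: lee_wpmul2l; first by rewrite lee_fin.
exact: (hm1 t).
Qed.

End path_estimates.

(** * Conclusion *)

(** For [y >= 1], [y + 1 <= 2 y] and [3 <= alpha + 1] give [(y + 1)^3 <= 8 y ^ (alpha + 1)]; the
    added mass [p y] covers [y = 0]. *)
Lemma summable_cube (R : realType) (p : nat -> R) (alpha : R) :
  run_length_distribution p -> 2 < alpha ->
  (\sum_(0 <= k <oo) (k%:R `^ (alpha + 1) * p k)%:E < +oo)%E ->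
  (\sum_(0 <= y <oo) (y.+1%:R ^+ 3 * p y)%:E < +oo)%E.
Proof.
move=> [p0 p1 _] alpha2 hmoment.
have m0 k : 0 <= k%:R `^ (alpha + 1) * p k by rewrite mulr_ge0 ?powR_ge0.
apply: (@le_lt_trans _ _ (\sum_(0 <= y <oo) ((p y)%:E +
    8%:E * (y%:R `^ (alpha + 1) * p y)%:E))%E).
  apply: lee_nneseries => [y _ _|y _]; first by rewrite lee_fin mulr_ge0 ?exprn_ge0.
  rewrite -EFinM -EFinD lee_fin mulrA -[X in X + _]mul1r -mulrDl.
  apply: ler_wpM2r => //; case: y => [|y].
    by rewrite expr1n lerDl mulr_ge0 // powR_ge0.
  have y1 : (1 : R) <= y.+1%:R by rewrite ler1n.
  have H : y.+1%:R ^+ 3 <= y.+1%:R `^ (alpha + 1).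
    rewrite -powR_mulrn //; apply: ler_powR => //; lra.
  rewrite -[y.+2%:R]natr1; move: H y1; set a : R := y.+1%:R; set b := _ `^ _.
  move=> H a1; apply: (@le_trans _ _ (8 * a ^+ 3)); last first.
    by apply: (@le_trans _ _ (8 * b)); [rewrite ler_wpM2l|rewrite lerDr].
  have -> : 8 * a ^+ 3 = (a + a) ^+ 3 by ring.
  by rewrite lerXn2r ?nnegrE ?lerD2l // addr_ge0 // (le_trans ler01).
rewrite nneseriesD; last 2 first.
- by move=> y _; rewrite lee_fin.
- by move=> y _; rewrite -EFinM lee_fin mulr_ge0.
rewrite p1 nneseriesZl; last by move=> y _; rewrite lee_fin.
rewrite lte_add_pinfty ?ltry // lte_mul_pinfty ?lee_fin //.
Qed.

Theorem theorem1 (R : realType) (d : measure_display) (T : measurableType d)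
    (P : probability T R) (p : nat -> R) (X : nat -> T -> nat)
    (theta : nat -> T -> R) (alpha gamma : R)
    (hp : run_length_distribution p)
    (hX : binary_renewal_process P p X)
    (htheta : forall n, is_cond_expectation P (history X n)
       (fun w => (sigma (X ^~ w) n)%:R) (theta n))
    (halpha : 2 < alpha)
    (hmoment : (\sum_(0 <= k <oo) (k%:R `^ (alpha + 1) * p k)%:E < +oo)%E)
    (hgamma0 : 0 < gamma)
    (hgamma : gamma < Num.min (1 - 2 / alpha) (1 / 3)) :
  {ae P, forall w,
    let x := X ^~ w in
    [/\ (fun n => (lambda gamma x n)%:R / n%:R : R) @ \oo --> (1 : R),
        (fun n => `|h_est gamma x n - theta (lambda gamma x n) w|) @ \oo
          --> (0 : R) &
        (fun n => \sum_(0 <= l <oo)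
           (`|p_est gamma x n l -
              p (l + tau x (lambda gamma x n))%N /
              (\big[+%R/0]_(tau x (lambda gamma x n) <= i <oo) p i)%R|)%:E)%E @ \oo
          --> (0%:E : \bar R)]}.
Proof.
have [M hM XE] := hX.
have p3 := summable_cube hp halpha hmoment.
have [gamma1 gamma2] : gamma < 1 /\ gamma - 2^-1 < 0.
  by move: hgamma; rewrite lt_min => /andP[_ H]; split; lra.
(* The cube root provides the three geometric factors used in [sqr_mul_geometric_summable]; [s < 1]
   because [gamma < 1/2]. *)
pose s : R := 2 `^ ((gamma - 2^-1) / 3).
have s0 : 0 < s by rewrite powR_gt0.
have s1 : s < 1 by apply: powR2_lt1; lra.
have sE : s ^+ 3 = 2 `^ (gamma - 2^-1).
  by rewrite -powR_mulrn ?ltW // -powRrM divfK.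
apply: filterS3 (ae_mean_chain_small hp hM p3 s0 s1)
  (ae_point_chain_small hp hM p3 s0 s1)
  (_ : {ae P, forall w, [/\ forall n i, M n w = i.+1 -> M n.+1 w = i,
     forall n, (psi (X ^~ w) <= n)%N -> theta n w =
       tail_sum p (tau (X ^~ w) n) (fun l => l%:R) / tail p (tau (X ^~ w) n) &
     forall e : R, 0 < e -> exists m0, forall m, (m0 <= m)%N ->
       (long_ages M m (2 ^ m) w)%:R / (2 ^ m)%N%:R <= e]}); last first.
  apply: filterS3 (ae_decr hM) (ae_cond_mean hM XE hp p3 htheta)
    (ae_long_ages_small hp hM p3) => w; exact: And3.
move=> w mean_small point_small [Mdecr thetaE ages_small] /=.
split.
- exact: lambda_cvg XE Mdecr hgamma0 gamma1 ages_small.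
- exact: (h_est_cvg XE Mdecr hgamma0 gamma1 ages_small s0 s1 sE mean_small thetaE).
- exact: (p_est_cvg XE Mdecr hgamma0 gamma1 ages_small s0 s1 sE point_small).
Qed.
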